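(* Let $A$ be a C*-algebra. Then the following are equivalent: (1) $A=\widetilde{A}[A,A]\widetilde{A}$, i.e. $A$ is generated by its commutators as a (not necessarily closed) ideal; (2) $A=A[A,A]A$, i.e. for every $a\in A$ there exist $n\in\mathbb{N}$ and $b_j,c_j,d_j,e_j\in A$ with $a=\sum_{j=1}^n b_j[c_j,d_j]e_j$; (3) $A=A\big[[A,A],[A,A]\big]A$; (4) $A$ is generated by its commutators as a ring; (5) $A=[A,A]^2$, i.e. for every $a\in A$ there exist $n\in\mathbb{N}$ and $b_j,c_j,d_j,e_j\in A$ with $a=\sum_{j=1}^n[b_j,c_j][d_j,e_j]$. Moreover, these conditions imply (6) $A$ admits no character. Further, (6) implies that $A[A,A]A$ is norm-dense in $A$, and thus all conditions (1)–(6) are equivalent if $A$ is unital.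
   Context: For $x,y\in A$, $[x,y]=xy-yx$. For subsets $X,Y$, $[X,Y]$ is the additive subgroup generated by all $[x,y]$ ($x\in X,y\in Y$), $XY$ is the additive subgroup generated by all products $xy$, $X^2=XX$, and $XYZ=(XY)Z$; no closures are taken. $\widetilde{A}$ denotes the minimal unitization of $A$ ($\widetilde A=A$ if $A$ is unital). A character on $A$ is a one-dimensional irreducible representation, equivalently a nonzero homomorphism $A\to\mathbb{C}$. *)

(* Defs.v *)
From HB Require Import structures.
From mathcomp Require Import all_boot all_order all_algebra.
From mathcomp Require Import all_classical all_reals all_analysis.
From mathcomp Require Import complex.
Import Order.TTheory GRing.Theory Num.Theory ComplexField.
Import numFieldNormedType.Exports.

Set Implicit Arguments.
Unset Strict Implicit.
Unset Printing Implicit Defensive.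

Local Open Scope ring_scope.
Local Open Scope classical_set_scope.

(* Scalars: the complex numbers C = R[i] over a real field R : realType.   *)
(* A (possibly non-unital) C*-algebra: a complex Banach space A together    *)
(* with an associative bilinear multiplication, a submultiplicative norm,   *)
(* a conjugate-linear anti-multiplicative involution and the C*-identity.   *)
Record cstar_axioms (R : realType) (A : completeNormedModType R[i])
    (mul : A -> A -> A) (star : A -> A) : Prop := CStarAxioms {
  cs_mulA : forall x y z, mul x (mul y z) = mul (mul x y) z;
  cs_mulDl : forall x y z, mul (x + y) z = mul x z + mul y z;
  cs_mulDr : forall x y z, mul x (y + z) = mul x y + mul x z;
  cs_mulZl : forall (k : R[i]) x y, mul (k *: x) y = k *: mul x y;
  cs_mulZr : forall (k : R[i]) x y, mul x (k *: y) = k *: mul x y;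
  cs_norm_mul : forall x y, `|mul x y| <= `|x| * `|y|;
  cs_starK : forall x, star (star x) = x;
  cs_starD : forall x y, star (x + y) = star x + star y;
  cs_starZ : forall (k : R[i]) x, star (k *: x) = (k^*)%C *: star x;
  cs_starM : forall x y, star (mul x y) = mul (star y) (star x);
  cs_cstar : forall x, `|mul (star x) x| = `|x| ^+ 2
}.

Record cstar_algebra (R : realType) := CStarAlgebra {
  cs_carrier :> completeNormedModType R[i];
  cs_mul : cs_carrier -> cs_carrier -> cs_carrier;
  cs_star : cs_carrier -> cs_carrier;
  cs_ax : cstar_axioms cs_mul cs_star
}.

Section Ops.
Variable R : realType.
Variable A : cstar_algebra R.

Local Notation mul := (@cs_mul R A).

(* additive subgroups of A *)
Definition is_addsubgroup (G : set A) : Prop :=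
  G 0 /\ (forall x y, G x -> G y -> G (x - y)).

(* additive subgroup generated by S (no closure taken) *)
Definition addgen (S : set A) : set A :=
  [set x | forall G, is_addsubgroup G -> S `<=` G -> G x].

(* subring (not necessarily unital) generated by S *)
Definition ringgen (S : set A) : set A :=
  [set x | forall G, is_addsubgroup G ->
     (forall y z, G y -> G z -> G (mul y z)) -> S `<=` G -> G x].

Definition commutator (x y : A) : A := mul x y - mul y x.

(* XY : additive subgroup generated by all products xy *)
Definition setmul (X Y : set A) : set A :=
  addgen [set z | exists x y, X x /\ Y y /\ z = mul x y].

(* [X,Y] : additive subgroup generated by all commutators [x,y] *)
Definition setcomm (X Y : set A) : set A :=
  addgen [set z | exists x y, X x /\ Y y /\ z = commutator x y].

(* Minimal unitization A~ = A (+) C, elements (a, l) standing for a + l*1.  *)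
(* Left/right multiplication of an element c of A by an element of A~.      *)
Definition unitz := (A * R[i])%type.
Definition unitz_mull (u : unitz) (c : A) : A := mul u.1 c + u.2 *: c.
Definition unitz_mulr (c : A) (u : unitz) : A := mul c u.1 + u.2 *: c.

(* A~ X, for X a subset of A (the result lies in A since A is an ideal of A~) *)
Definition unitz_setmull (X : set A) : set A :=
  addgen [set z | exists (u : unitz) x, X x /\ z = unitz_mull u x].
(* X A~, for X a subset of A *)
Definition unitz_setmulr (X : set A) : set A :=
  addgen [set z | exists x (u : unitz), X x /\ z = unitz_mulr x u].

(* a character: a nonzero (C-linear, multiplicative) homomorphism A -> C *)
Definition is_character (phi : A -> R[i]) : Prop :=
  [/\ forall x y, phi (x + y) = phi x + phi y,
      forall (k : R[i]) x, phi (k *: x) = k * phi x,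
      forall x y, phi (mul x y) = phi x * phi y
    & exists x, phi x != 0].

Definition has_character : Prop := exists phi, is_character phi.

Definition cs_unital : Prop := exists e : A, forall x, mul e x = x /\ mul x e = x.

End Ops.

(* Main.v *)
Require Import Defs.
From HB Require Import structures.
From mathcomp Require Import all_boot all_order all_algebra.
From mathcomp Require Import all_classical all_reals all_analysis.
From mathcomp Require Import complex.
From mathcomp Require Import ring lra zify.
Import Order.TTheory GRing.Theory Num.Theory ComplexField.
Import numFieldNormedType.Exports Normc.
Set Implicit Arguments.
Unset Strict Implicit.
Unset Printing Implicit Defensive.
Local Open Scope ring_scope.
Local Open Scope classical_set_scope.

(** Every self-adjoint [h] can be written [h = c_n b^n] for all [n] with a single [b],
    namely [b = F(h)] where [F] is continuous and tends to 0 at 0 more slowly than any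
    power.  So [A = AAA], whence (1) => (2), and an ideal meeting the powers of every
    element is all of [A].  For (2) => (3), if the ideal generated by [[L,L]],
    [L = [A,A]], missed all powers of [b], an ideal maximal with that property would be
    prime, and in a prime ring [[L,L] = 0] forces [L = 0].  (3) => (5) is Herstein's
    inclusion [A[L,L]A <= L + L^2].

    If [A[A,A]A] is not dense, the distance to it is a nonzero C*-seminorm killing
    commutators.  A minimal power-multiplicative seminorm below it that keeps the value at
    a chosen element is multiplicative, and by Gelfand-Mazur it is the modulus of a
    character.  The same result applied to polynomials in [h] bounds [f(h)] by the supremum
    of [f] on a real interval, which provides the functional calculus used above. *)

(** * Ideals and commutators *)

(** No closures are taken, so approximate units and norm estimates do not by themselves show that an
    ideal is all of [A]; exact factorizations are needed. The exponent supplied by the prime ideal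
    argument depends on [b] and is not known in advance, which is why one [b] must serve every [n].
    As [A] may lack a unit, the unitization is simulated: [F(h)] is a left multiplication, and
    polynomials without constant term are replaced by their cofactors of ['X], with product
    [F * 'X * G]. Modulo a C*-seminorm that kills commutators every element is normal, hence
    [q (x x) = q x ^+ 2]; this is the source of power-multiplicativity. Minimality upgrades it
    because the limit of [p(f^n x) / p(f)^n] is again such a seminorm below [p], so it equals [p]
    once it keeps the chosen value. In (3) => (5), Herstein's inclusion gives only [A = L + L^2];
    bracketing this decomposition with itself puts [L] into [L^2]. *)

Section RingTheory.
Variables (R : realType) (A : cstar_algebra R).

Local Notation "x ** y" := (@cs_mul R A x y) (at level 40, left associativity).
Local Notation AA := (setT : set A).
Local Notation L := (@setcomm R A AA AA).

Implicit Types (x y z u v w a b c : A) (G P I S X Y : set A).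

Lemma csmulA x y z : x ** (y ** z) = x ** y ** z.
Proof. exact: (cs_mulA (@cs_ax R A)). Qed.

Lemma csmulDl x y z : (x + y) ** z = x ** z + y ** z.
Proof. exact: (cs_mulDl (@cs_ax R A)). Qed.

Lemma csmulDr x y z : x ** (y + z) = x ** y + x ** z.
Proof. exact: (cs_mulDr (@cs_ax R A)). Qed.

Lemma csmulZl (k : R[i]) x y : (k *: x) ** y = k *: (x ** y).
Proof. exact: (cs_mulZl (@cs_ax R A)). Qed.

Lemma csmulZr (k : R[i]) x y : x ** (k *: y) = k *: (x ** y).
Proof. exact: (cs_mulZr (@cs_ax R A)). Qed.

Lemma csmul0l x : 0 ** x = 0.
Proof. by have := csmulZl 0 0 x; rewrite !scale0r. Qed.

Lemma csmul0r x : x ** 0 = 0.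
Proof. by have := csmulZr 0 x 0; rewrite !scale0r. Qed.

Lemma csmulNl x y : (- x) ** y = - (x ** y).
Proof. by rewrite -scaleN1r csmulZl scaleN1r. Qed.

Lemma csmulNr x y : x ** (- y) = - (x ** y).
Proof. by rewrite -scaleN1r csmulZr scaleN1r. Qed.

Lemma csmulBl x y z : (x - y) ** z = x ** z - y ** z.
Proof. by rewrite csmulDl csmulNl. Qed.

Lemma csmulBr x y z : x ** (y - z) = x ** y - x ** z.
Proof. by rewrite csmulDr csmulNr. Qed.

Section Subgroup.
Variables (G : set A) (GG : is_addsubgroup G).

Lemma subgroup0 : G 0. Proof. exact: GG.1. Qed.

Lemma subgroupB x y : G x -> G y -> G (x - y).
Proof. exact: GG.2. Qed.

Lemma subgroupN x : G x -> G (- x).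
Proof. by move=> Gx; rewrite -sub0r; apply: subgroupB => //; exact: subgroup0. Qed.

Lemma subgroupD x y : G x -> G y -> G (x + y).
Proof. by move=> Gx Gy; rewrite -(opprK y); apply/subgroupB/subgroupN. Qed.

End Subgroup.

Lemma sub_addgen S : S `<=` addgen S.
Proof. by move=> x Sx G GG; exact. Qed.

Lemma addgen_subgroup S : is_addsubgroup (addgen S).
Proof.
split=> [G GG _|x y Sx Sy G GG SG]; first exact: subgroup0.
by apply: subgroupB => //; [exact: Sx|exact: Sy].
Qed.

Lemma addgen_min S G : is_addsubgroup G -> S `<=` G -> addgen S `<=` G.
Proof. by move=> GG SG x; apply. Qed.

Lemma setmul_mem X Y x y : X x -> Y y -> setmul X Y (x ** y).
Proof. by move=> Xx Yy; apply: sub_addgen; exists x, y. Qed.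

Lemma setmul_min X Y G : is_addsubgroup G ->
  (forall x y, X x -> Y y -> G (x ** y)) -> setmul X Y `<=` G.
Proof. by move=> GG H; apply: addgen_min => // _ [x [y [Xx [Yy ->]]]]; exact: H. Qed.

Lemma setcomm_mem X Y x y : X x -> Y y -> setcomm X Y (commutator x y).
Proof. by move=> Xx Yy; apply: sub_addgen; exists x, y. Qed.

Lemma comm_setcomm x y : L (commutator x y).
Proof. by apply: setcomm_mem. Qed.

Lemma setcomm_min X Y G : is_addsubgroup G ->
  (forall x y, X x -> Y y -> G (commutator x y)) -> setcomm X Y `<=` G.
Proof. by move=> GG H; apply: addgen_min => // _ [x [y [Xx [Yy ->]]]]; exact: H. Qed.

Lemma subgroup_preim (f : A -> A) G : f 0 = 0 -> {morph f : x y / x - y} ->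
  is_addsubgroup G -> is_addsubgroup (f @^-1` G).
Proof.
move=> f0 fB GG; split=> [|x y Gx Gy]; rewrite /preimage /= ?f0 ?fB.
  exact: subgroup0.
exact: subgroupB.
Qed.

Lemma subgroup_mull a G : is_addsubgroup G -> is_addsubgroup [set x | G (a ** x)].
Proof.
move=> GG; apply: (@subgroup_preim (fun x => a ** x)) => //.
  exact: csmul0r.
by move=> x y; exact: csmulBr.
Qed.

Lemma subgroup_mulr a G : is_addsubgroup G -> is_addsubgroup [set x | G (x ** a)].
Proof.
move=> GG; apply: (@subgroup_preim (fun x => x ** a)) => //.
  exact: csmul0l.
by move=> x y; exact: csmulBl.
Qed.

Lemma subgroup_forall (T : Type) (F : T -> set A) :
  (forall t, is_addsubgroup (F t)) -> is_addsubgroup [set x | forall t, F t x].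
Proof.
move=> H; split=> [t|x y Fx Fy t]; first exact: subgroup0.
by apply: subgroupB; [exact: H|exact: Fx|exact: Fy].
Qed.

Lemma subgroup_mullr G : is_addsubgroup G ->
  is_addsubgroup [set x | forall a b, G (a ** x ** b)].
Proof.
move=> GG; apply: subgroup_forall => a; apply: subgroup_forall => b.
exact: (subgroup_mull a (subgroup_mulr b GG)).
Qed.

Definition ideal G := is_addsubgroup G /\ forall a x, G x -> G (a ** x) /\ G (x ** a).

Lemma ideal_setmul2 X : ideal (setmul (setmul AA X) AA).
Proof.
split; first exact: addgen_subgroup.
move=> a x Hx; split; last first.
  move: x Hx; apply: setmul_min; first exact/subgroup_mulr/addgen_subgroup.
  by move=> x y Hx _; rewrite -csmulA; exact: setmul_mem.
move: x Hx; apply: setmul_min; first exact/subgroup_mull/addgen_subgroup.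
move=> x y + _; rewrite csmulA; move=> Hx; apply: setmul_mem => //.
move: x Hx; apply: setmul_min; first exact/subgroup_mull/addgen_subgroup.
by move=> x z _ Xz; rewrite csmulA; exact: setmul_mem.
Qed.

Lemma setmul2_mem X a x b : X x -> setmul (setmul AA X) AA (a ** x ** b).
Proof. by move=> Xx; apply: setmul_mem => //; exact: setmul_mem. Qed.

Lemma setmul2_min X G : is_addsubgroup G ->
  (forall a x b, X x -> G (a ** x ** b)) -> setmul (setmul AA X) AA `<=` G.
Proof.
move=> GG H; apply: setmul_min => // x y + _; move: x.
by apply: setmul_min; [exact: subgroup_mulr|move=> a x _ Xx; exact: H].
Qed.

Local Notation comm := (@commutator R A).

Lemma commMr x y z : comm x (y ** z) = comm x y ** z + y ** comm x z.
Proof.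
by rewrite /commutator csmulBl csmulBr !csmulA addrA subrK.
Qed.

Lemma commMl x y z : comm (x ** y) z = x ** comm y z + comm x z ** y.
Proof.
by rewrite /commutator csmulBl csmulBr !csmulA addrA subrK.
Qed.

Lemma commN x y : - comm x y = comm y x.
Proof. by rewrite /commutator opprB. Qed.

Lemma comm0 x : comm x 0 = 0.
Proof. by rewrite /commutator csmul0l csmul0r subrr. Qed.

Lemma commD x y z : comm x (y + z) = comm x y + comm x z.
Proof. by rewrite /commutator csmulDl csmulDr opprD addrACA. Qed.

Lemma commB x y z : comm x (y - z) = comm x y - comm x z.
Proof. by rewrite commD {2}/commutator csmulNl csmulNr -opprD. Qed.

(** Off by one: this is [b^(n+1)], since [A] need not contain a zeroth power. *)
Definition cspow b n := iter n (fun x => b ** x) b.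

Lemma cspowD b m n : cspow b m ** cspow b n = cspow b (m + n).+1.
Proof. by elim: m => [|m IH] //=; rewrite -csmulA IH. Qed.

(* Ideals maximal with respect to avoiding the powers of [b] are prime. *)
Lemma prime_avoiding_powers b I : ideal I -> (forall n, ~ I (cspow b n)) ->
  exists P, [/\ ideal P, I `<=` P, ~ P b &
    forall x y, (forall z, P (x ** z ** y)) -> P x \/ P y].
Proof.
move=> [IG IM] bI.
(* The union with [I] makes [good] hold for the empty set, which is the union of the empty chain in
   [Zorn_bigcup]. *)
pose good X := ideal (X `|` I) /\ forall n, ~ (X `|` I) (cspow b n).
have [|X [gX maxX]] := @Zorn_bigcup _ good.
  move=> F Fgood Ftot; split.
    have key x y : (\bigcup_(X in F) X `|` I) x -> (\bigcup_(X in F) X `|` I) y ->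
        (I x /\ I y) \/ exists X, [/\ F X, (X `|` I) x & (X `|` I) y].
      move=> [[X FX Xx]|Ix] [[Y FY Yy]|Iy]; last by left.
      - right; have [XY|YX] := Ftot _ _ FX FY.
          by exists Y; split=> //; left=> //; exact: XY.
        by exists X; split=> //; left=> //; exact: YX.
      - by right; exists X; split=> //; [left|right].
      - by right; exists Y; split=> //; [right|left].
    split.
      split; first by right; exact: subgroup0.
      move=> x y Ux Uy; have [[Ix Iy]|[X [FX Xx Xy]]] := key _ _ Ux Uy.
        by right; exact: subgroupB.
      have [[XG _] _] := Fgood _ FX.
      by have [Xxy|] := subgroupB XG Xx Xy; [left; exists X|right].
    move=> a x Ux; have [[Ix Iy]|[X [FX Xx Xy]]] := key _ _ Ux Ux.
      by have [] := IM a x Ix; split; right.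
    have [[_ XM] _] := Fgood _ FX; have [H1 H2] := XM a x Xx.
    by split; [case: H1|case: H2] => ?; [left; exists X|right|left; exists X|right].
  move=> n [[X FX Xb]|]; last exact: bI.
  by have [_ /(_ n)] := Fgood _ FX; apply; left.
set P := X `|` I in gX *.
have [[PG PM] bP] := gX.
have maxP J : ideal J -> P `<=` J -> ~ (J `<=` P) -> exists n, J (cspow b n).
  move=> iJ PJ nJP; apply: contrapT => nJ; apply: (maxX J).
    split; first by move=> x Xx; apply: PJ; left.
    by move=> JX; apply: nJP => x /JX; left.
  have JI : J `|` I = J.
    by apply/seteqP; split=> x; [case=> // Ix; apply: PJ; right|left].
  by rewrite /good JI; split=> // n Jn; apply: nJ; exists n.
pose gen c := [set x | forall J, ideal J -> P `<=` J -> J c -> J x].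
have gen_ideal c : ideal (gen c).
  split; first (split=> [J [JG _] _ _|x y gx gy J iJ PJ Jc]).
  - exact: subgroup0.
  - by apply: subgroupB (gx _ iJ PJ Jc) (gy _ iJ PJ Jc); exact: iJ.1.
  - by move=> a x gx; split=> J iJ PJ Jc; have [] := iJ.2 a x (gx _ iJ PJ Jc).
have gen_pow c : ~ P c -> exists n, gen c (cspow b n).
  move=> Pc; apply: maxP => //; first by move=> x Px J _ PJ _; exact: PJ.
  by move=> /(_ c) cP; apply/Pc/cP => J.
exists P; split=> //; [by right|exact: bP 0|].
move=> x y xPy; apply: contrapT => /not_orP[/gen_pow[m xm] /gen_pow[n yn]].
(* Two ideal quotients: [J1] contains [P] and [x], hence [b^(m+1)]; so [J2] contains [P] and [y],
   hence [b^(n+1)]. With [b] as middle factor, a power of [b] falls into [P]. *)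
pose J1 := [set s | forall z, P (s ** z ** y)].
have iJ1 : ideal J1.
  split; first by apply: subgroup_forall => z;
    apply: (subgroup_mulr z (subgroup_mulr y PG)).
  move=> a s Js; split=> z; last by rewrite -(csmulA s); exact: Js.
  by rewrite -!csmulA; apply: (PM _ _ _).1; rewrite csmulA; exact: Js.
have {}xm : J1 (cspow b m).
  apply: xm => // s Ps z.
  by rewrite -csmulA; apply: (PM _ _ _).2.
pose J2 := [set s | forall z, P (cspow b m ** z ** s)].
have iJ2 : ideal J2.
  split; first by apply: subgroup_forall => z; apply: (subgroup_mull _ PG).
  move=> a s Js; split=> z; first by rewrite csmulA -(csmulA _ z); exact: Js.
  by rewrite csmulA; apply: (PM _ _ _).2; exact: Js.
have {}yn : J2 (cspow b n) by apply: yn => // s Ps z; apply: (PM _ _ _).1.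
by have := yn b; rewrite (cspowD b m 0) cspowD => /bP.
Qed.

(** With [u] a commutator, expanding [[u, [s, s y]]] puts [[u,s][s,y]] in [P]; a free factor can be
    inserted to get [[u,s] y [s,z]], and primeness at [z = u] makes commutators central modulo [P].
    Expanding [[[x, x w], z]] in the same way then puts [[x,z] w [x,z]] in [P]. *)
Lemma prime_comm_comm P : ideal P ->
  (forall x y, (forall z, P (x ** z ** y)) -> P x \/ P y) ->
  (forall x y z w, P (comm (comm x y) (comm z w))) ->
  forall x y, P (comm x y).
Proof.
move=> [PG PM] prP PLL.
have subP u v : P (u + v) -> P v -> P u.
  by move=> uv v'; rewrite -(addrK v u); exact: subgroupB.
have subP' u v : P (u + v) -> P u -> P v by rewrite addrC; exact: subP.
have commXX x y : comm x (x ** y) = x ** comm x y.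
  by rewrite commMr {1}/commutator subrr csmul0l add0r.
have central a b x : P (comm (comm a b) x).
  set u := comm a b.
  have H1 s y : P (comm u s ** comm s y).
    have := PLL a b s (s ** y); rewrite commXX commMr => /subP; apply.
    by apply: (PM _ _ _).1; exact: PLL.
  have H2 s y z : P (comm u s ** y ** comm s z).
    have := H1 s (y ** z); rewrite commMr csmulDr => /subP'.
    rewrite !csmulA; apply; apply: (PM _ _ _).2; exact: H1.
  have [//|] := prP (comm u x) (comm x u) (fun y => H2 x y u).
  by rewrite -commN -/u => /(subgroupN PG); rewrite opprK.
move=> x y.
have H1 z w : P (comm x z ** comm x w).
  have := central x (x ** w) z; rewrite commXX commMl => /subP'; apply.
  by apply: (PM _ _ _).1; exact: central.
have H2 z w : P (comm x z ** w ** comm x z).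
  have := H1 (z ** w) z; rewrite commMr csmulDl => /subP; apply.
  by rewrite -csmulA; apply: (PM _ _ _).1; exact: H1.
by have [] := prP (comm x y) (comm x y) (H2 y).
Qed.

Lemma power_in_double_commutator_ideal b :
  setmul (setmul AA L) AA = AA ->
  exists n, setmul (setmul AA (setcomm L L)) AA (cspow b n).
Proof.
move=> ALA; apply: contrapT => /forallNP bI.
have [P [iP IP Pb prP]] := prime_avoiding_powers (ideal_setmul2 _) bI.
have LP : L `<=` P.
  apply: setcomm_min => [|x y _ _]; first exact: iP.1.
  apply: prime_comm_comm => // {}x {}y z w.
  set u := comm _ _.
  have Hu s t : P (s ** u ** t).
    by apply: IP; apply: setmul2_mem; apply: setcomm_mem; exact: comm_setcomm.
  (* So far [u] is known to lie in [P] only between two factors; primeness against [b], which is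
     outside [P], strips them one at a time. *)
  have {}Hu t : P (u ** t).
    by have [s|//|//] := prP b (u ** t); rewrite csmulA.
  by case: (prP u b) => // s; exact: (iP.2 b _ (Hu s)).2.
apply: Pb; have : AA b by []; rewrite -ALA; move: b {bI}.
apply: setmul2_min; first exact: iP.1.
by move=> a x c /LP Px; apply: (iP.2 _ _ _).2; apply: (iP.2 _ _ _).1.
Qed.

(** For [u], [v] in [L], [a[u,v] = [au,v] - [a,v]u] lies in [L + L^2]. A right factor is moved to
    the left by [wb = [w,b] + bw]. *)
Lemma lie_double_commutator_ideal :
  setmul (setmul AA (setcomm L L)) AA `<=`
  [set x | exists u v, [/\ L u, setmul L L v & x = u + v]].
Proof.
set G := [set x | _].
have LG : is_addsubgroup L := addgen_subgroup _.
have L2G : is_addsubgroup (setmul L L) := addgen_subgroup _.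
have GG : is_addsubgroup G.
  split; first by exists 0, 0; split; [exact: subgroup0|exact: subgroup0|rewrite addr0].
  move=> _ _ [u [v [Lu Lv ->]]] [u' [v' [Lu' Lv' ->]]].
  by exists (u - u'), (v - v'); rewrite opprD addrACA; split=> //;
    [exact: (subgroupB LG)|exact: (subgroupB L2G)].
apply: setmul2_min => // a w b Lw; move: w Lw a b.
suff : setcomm L L `<=` [set w | forall a b, G (a ** w ** b)] by [].
apply: setcomm_min; first exact: subgroup_mullr.
move=> u v Lu Lv.
have mulG a : G (a ** comm u v).
  exists (comm (a ** u) v), (- (comm a v ** u)); split.
  - exact: comm_setcomm.
  - apply: (subgroupN L2G); apply: setmul_mem => //; exact: comm_setcomm.
  - by rewrite commMl addrK.
move=> a b; set w := a ** _.
have -> : w ** b = comm w b + b ** w by rewrite /commutator subrK.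
apply: (subgroupD GG); last by rewrite csmulA; exact: mulG.
exists (comm w b), 0; split; [exact: comm_setcomm|exact: subgroup0|by rewrite addr0].
Qed.

(** Here [A = L + L^2]. Each derivation [[a, -]] maps [A] into [L], hence [L^2] into [L^2], and
    [[L,L]] lies in [L^2] as well; so every commutator lies in [L^2]. *)
Lemma setmul_comm_comm : setmul (setmul AA (setcomm L L)) AA = AA ->
  setmul L L = AA.
Proof.
move=> H; have L2G : is_addsubgroup (setmul L L) := addgen_subgroup _.
have dec x : exists u v, [/\ L u, setmul L L v & x = u + v].
  by apply: lie_double_commutator_ideal; rewrite H.
have commL2 a : setmul L L `<=` [set v | setmul L L (comm a v)].
  apply: setmul_min.
    by apply: (@subgroup_preim (comm a)) => //; [exact: comm0|exact: commB].
  move=> u v Lu Lv; rewrite /= commMr.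
  by apply: (subgroupD L2G); apply: setmul_mem => //; exact: comm_setcomm.
have LL2 : L `<=` setmul L L.
  apply: setcomm_min => // a b _ _.
  have [u [v [Lu Lv ->]]] := dec b; rewrite commD.
  apply: (subgroupD L2G); last exact: commL2.
  rewrite -commN; apply: (subgroupN L2G).
  have [u' [v' [Lu' Lv' ->]]] := dec a; rewrite commD.
  apply: (subgroupD L2G); last exact: commL2.
  by apply: (subgroupB L2G); exact: setmul_mem.
apply/seteqP; split=> // x _; have [u [v [Lu Lv ->]]] := dec x.
by apply: (subgroupD L2G) => //; exact: LL2.
Qed.

End RingTheory.

(** * Minimal power-multiplicative seminorms *)

(** Lets two indices vary independently when submultiplicativity passes to an infimum. If [c > 0],
    no element of [F] vanishes, so one may divide. *)
Lemma le_mul_inf (R : realType) (E F : set R) (c : R) : E !=set0 -> F !=set0 ->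
  (forall a, E a -> 0 <= a) -> (forall b, F b -> 0 <= b) ->
  (forall a b, E a -> F b -> c <= a * b) -> c <= inf E * inf F.
Proof.
move=> E0 F0 Ege Fge H.
have iE : 0 <= inf E by apply: lb_le_inf.
have iF : 0 <= inf F by apply: lb_le_inf.
have [c0|c0] := leP c 0; first exact: (le_trans c0 (mulr_ge0 iE iF)).
have Fpos b : F b -> 0 < b.
  move=> Fb; rewrite lt0r Fge // andbT; apply/eqP => b0.
  by case: E0 => a Ea; have := H a b Ea Fb; rewrite b0 mulr0 leNgt c0.
have H1 b : F b -> c <= inf E * b.
  move=> Fb; rewrite -ler_pdivrMr ?Fpos //; apply: lb_le_inf => // a Ea.
  by rewrite ler_pdivrMr ?Fpos //; exact: H.
have iEpos : 0 < inf E.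
  rewrite lt0r iE andbT; apply/eqP => e0.
  by case: F0 => b Fb; have := H1 b Fb; rewrite e0 mul0r leNgt c0.
rewrite mulrC -ler_pdivrMr //; apply: lb_le_inf => // b Fb.
by rewrite ler_pdivrMr // mulrC; exact: H1.
Qed.

Section Seminorms.
Variables (R : realType) (V : lmodType R[i]) (mul : V -> V -> V).
Hypothesis mulA : forall x y z, mul x (mul y z) = mul (mul x y) z.
Hypothesis mulDl : forall x y z, mul (x + y) z = mul x z + mul y z.
Hypothesis mulDr : forall x y z, mul x (y + z) = mul x y + mul x z.
Hypothesis mulZl : forall (c : R[i]) x y, mul (c *: x) y = c *: mul x y.
Hypothesis mulZr : forall (c : R[i]) x y, mul x (c *: y) = c *: mul x y.

(** The product is an explicit parameter because both [A] and a space of polynomials with a twisted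
    product are instances. *)
Record cseminorm (p : V -> R) : Prop := CSeminorm {
  csnD : forall x y, p (x + y) <= p x + p y;
  csnZ : forall (c : R[i]) x, p (c *: x) = normc c * p x;
  csnM : forall x y, p (mul x y) <= p x * p y;
  csnX : forall x, p (mul x x) = p x ^+ 2;
  csnC : forall x y, p (mul x y - mul y x) = 0
}.

Let mulNl x y : mul (- x) y = - mul x y.
Proof. by rewrite -scaleN1r mulZl scaleN1r. Qed.
Let mulNr x y : mul x (- y) = - mul x y.
Proof. by rewrite -scaleN1r mulZr scaleN1r. Qed.
Let mulBl x y z : mul (x - y) z = mul x z - mul y z.
Proof. by rewrite mulDl mulNl. Qed.
Let mulBr x y z : mul x (y - z) = mul x y - mul x z.
Proof. by rewrite mulDr mulNr. Qed.

Section Theory.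
Variables (p : V -> R) (cp : cseminorm p).

Lemma csn0 : p 0 = 0.
Proof. by have := csnZ cp 0 0; rewrite scale0r normc0 mul0r. Qed.

Lemma csnN x : p (- x) = p x.
Proof. by rewrite -scaleN1r (csnZ cp) normcN normc1 mul1r. Qed.

Lemma csn_ge0 x : 0 <= p x.
Proof.
have := csnD cp x (- x); rewrite subrr csn0 csnN -mulr2n.
by rewrite pmulrn_lge0.
Qed.

Lemma csnB x y : p (x - y) <= p x + p y.
Proof. by rewrite (le_trans (csnD cp _ _)) // csnN. Qed.

(** Equality in the quotient by the kernel of [p], a commutative algebra by [csnC]. *)
Definition nullv x y := p (x - y) = 0.

Lemma null_sym x y : nullv x y -> nullv y x.
Proof. by rewrite /nullv -opprB csnN. Qed.

Lemma null_trans x y z : nullv x y -> nullv y z -> nullv x z.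
Proof.
move=> xy yz; apply/eqP; rewrite eq_le csn_ge0 andbT -(subrKA y).
by rewrite (le_trans (csnD cp _ _)) // xy yz addr0.
Qed.

Lemma null_le x y : nullv x y -> p x <= p y.
Proof. by move=> xy; rewrite -[x](subrK y) (le_trans (csnD cp _ _)) // xy add0r. Qed.

Lemma null_eq x y : nullv x y -> p x = p y.
Proof. by move=> xy; apply/eqP; rewrite eq_le !null_le //; exact: null_sym. Qed.

Lemma null_mull z x y : nullv x y -> nullv (mul z x) (mul z y).
Proof.
move=> xy; apply/eqP; rewrite eq_le csn_ge0 andbT -mulBr.
by rewrite (le_trans (csnM cp _ _)) // xy mulr0.
Qed.

Lemma null_mulr z x y : nullv x y -> nullv (mul x z) (mul y z).
Proof.
move=> xy; apply/eqP; rewrite eq_le csn_ge0 andbT -mulBl.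
by rewrite (le_trans (csnM cp _ _)) // xy mul0r.
Qed.

Lemma null_iter_mul f x n y :
  nullv (mul x (iter n (mul f) y)) (iter n (mul f) (mul x y)).
Proof.
elim: n => [|n IH] /=; first by rewrite /nullv subrr csn0.
rewrite mulA; apply: (@null_trans _ (mul (mul f x) (iter n (mul f) y))).
  by apply: null_mulr; exact: (csnC cp).
by rewrite -mulA; exact: null_mull.
Qed.

Lemma iter_mul_mul f n x y : mul (iter n (mul f) x) y = iter n (mul f) (mul x y).
Proof. by elim: n => //= n IH; rewrite -mulA IH. Qed.

Lemma csn_iter_mul f m n x y :
  p (iter (m + n) (mul f) (mul x y)) = p (mul (iter m (mul f) x) (iter n (mul f) y)).
Proof.
apply/esym/null_eq; rewrite iter_mul_mul iterD.
elim: m => [|m IH] /=; first exact: null_iter_mul.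
exact: null_mull.
Qed.

Lemma csn_iter_le f n x : p (iter n (mul f) x) <= p f ^+ n * p x.
Proof.
elim: n => [|n IH] /=; first by rewrite mul1r.
rewrite (le_trans (csnM cp _ _)) // exprS -mulrA.
by apply: ler_wpM2l; first exact: csn_ge0.
Qed.

(** The iterate is [f^(n+1)]. Repeated squaring settles exponents that are powers of two; a strict
    drop at exponent [n+1] would persist, by submultiplicativity, up to a larger [2^j]. *)
Lemma csn_iter_self f n : p (iter n (mul f) f) = p f ^+ n.+1.
Proof.
have powlt : exists j, (n.+1 <= 2 ^ j)%N by exists n.+1; exact: ltnW (ltn_expl _ _).
have pow2 j : p (iter (2 ^ j).-1 (mul f) f) = p f ^+ (2 ^ j).
  elim: j => [|j IH] //=.
  have := csnX cp (iter (2 ^ j).-1 (mul f) f).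
  rewrite -csn_iter_mul IH -exprM -iterSr expnSr => <-; congr p; congr iter.
  by have := expn_gt0 2 j; case: (2 ^ j)%N => //= k _; rewrite muln2 -addnn.
have [j jn] := powlt.
apply/eqP; rewrite eq_le; apply/andP; split.
  by rewrite (le_trans (csn_iter_le _ _ _)) // exprSr.
have [f0|f0] := eqVneq (p f) 0; first by rewrite f0 expr0n csn_ge0.
have fpos : 0 < p f by rewrite lt0r f0 csn_ge0.
rewrite -(ler_pM2l (exprn_gt0 (2 ^ j - n.+1) fpos)) -exprD subnK // -pow2.
have -> : (2 ^ j).-1 = ((2 ^ j - n.+1) + n)%N.
  by rewrite -subn1 -[in LHS](subnK jn) addnS subn1.
by rewrite iterD; exact: csn_iter_le.
Qed.

End Theory.

(** The existential indices let this cover both a chain in Zorn's lemma and the sequence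
    [p(f^n x) / p(f)^n], whose terms need not be submultiplicative one by one. *)
Lemma inf_cseminorm (I : Type) (F : I -> V -> R) (i0 : I) :
  (forall i x, 0 <= F i x) ->
  (forall i (c : R[i]) x, F i (c *: x) = normc c * F i x) ->
  (forall i j, exists l, forall x y, F l (x + y) <= F i x + F j y) ->
  (forall i j, exists l, forall x y, F l (mul x y) <= F i x * F j y) ->
  (forall i, exists l, forall x, F l x ^+ 2 <= F i (mul x x)) ->
  (forall x y, exists i, F i (mul x y - mul y x) = 0) ->
  cseminorm (fun x => inf (range (F^~ x))).
Proof.
move=> F0 FZ FD FM FX FC; pose m x := inf (range (F^~ x)).
have m_le i x : m x <= F i x by apply: ge_inf; [exists 0 => _ [j _ <-]|exists i].
have ne x : range (F^~ x) !=set0 by exists (F i0 x), i0.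
have le_m x c : (forall i, c <= F i x) -> c <= m x.
  by move=> H; apply: lb_le_inf => // _ [i _ <-].
have m0 x : 0 <= m x by apply: le_m.
have leZ (c : R[i]) x : normc c * m x <= m (c *: x).
  apply: le_m => i; rewrite FZ ler_wpM2l //.
  by case: c => a b /=; exact: sqrtr_ge0.
have mM x y : m (mul x y) <= m x * m y.
  apply: le_mul_inf => //; [by move=> _ [i _ <-]|by move=> _ [i _ <-]|].
  move=> _ _ [i _ <-] [j _ <-]; have [l Hl] := FM i j.
  exact: le_trans (m_le l _) (Hl _ _).
split => //.
- move=> x y; rewrite -/(m _) -/(m _) -/(m _) -lerBlDl; apply: (le_m _) => j.
  rewrite lerBlDl -lerBlDr; apply: le_m => i; rewrite lerBlDr.
  by have [l Hl] := FD i j; exact: le_trans (m_le l _) (Hl _ _).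
- move=> c x; rewrite -/(m _) -/(m _); apply/eqP; rewrite eq_le leZ andbT.
  have [->|c0] := eqVneq c 0.
    by rewrite scale0r normc0 mul0r (le_trans (m_le i0 _)) // -(scale0r 0) FZ normc0 mul0r.
  have n0 : normc c != 0 by apply: contra c0 => /eqP/eq0_normc ->.
  have npos : 0 < normc c.
    by rewrite lt0r n0 /=; case: (c) => a b; exact: sqrtr_ge0.
  by rewrite -ler_pdivrMl // -normcV (le_trans (leZ _ _)) // scalerA mulVf // scale1r.
- move=> x; rewrite -/(m _) -/(m _); apply/eqP; rewrite eq_le expr2 mM /= -expr2.
  apply: le_m => i; have [l Hl] := FX i; rewrite (le_trans _ (Hl x)) //.
  by rewrite lerXn2r // nnegrE.
- move=> x y; rewrite -/(m _); apply/eqP; rewrite eq_le m0 andbT.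
  by have [i <-] := FC x y.
Qed.

(* [q x] is the limit of the decreasing sequence [p(f^n x) / p(f)^n]. *)
Lemma localize_cseminorm p f : cseminorm p -> 0 < p f ->
  exists q, [/\ cseminorm q, forall x, q x <= p x,
    forall x, p f * q x <= p (mul f x) &
    forall x, (forall n, p (iter n (mul f) x) = p f ^+ n * p x) -> q x = p x].
Proof.
move=> cp fpos.
pose F n x := p (iter n (mul f) x) / p f ^+ n.
have Fpos n : 0 < p f ^+ n by exact: exprn_gt0.
have F_anti n m x : F (m + n)%N x <= F n x.
  rewrite /F ler_pdivrMr // exprD mulrCA mulfVK ?gt_eqF //.
  by rewrite iterD csn_iter_le.
have iterB n x y : iter n (mul f) (x - y) = iter n (mul f) x - iter n (mul f) y.
  by elim: n => //= n ->; rewrite mulBr.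
have iterDr n x y : iter n (mul f) (x + y) = iter n (mul f) x + iter n (mul f) y.
  by elim: n => //= n ->; rewrite mulDr.
have iterZ n (c : R[i]) x : iter n (mul f) (c *: x) = c *: iter n (mul f) x.
  by elim: n => //= n ->; rewrite mulZr.
have FM m n x y : F (m + n)%N (mul x y) <= F m x * F n y.
  rewrite /F csn_iter_mul // mulrACA -invfM -exprD ler_pM2r ?invr_gt0 //.
  exact: csnM.
have F0 n x : 0 <= F n x by rewrite /F divr_ge0 ?(csn_ge0 cp) // ltW.
exists (fun x => inf (range (F^~ x))).
have lb x : has_lbound (range (F^~ x)) by exists 0 => _ [j _ <-].
split.
- apply: inf_cseminorm => //; first exact: 0%N.
  + by move=> n c x; rewrite /F iterZ (csnZ cp) mulrA.
  + move=> m n; exists (m + n)%N => x y; rewrite /F iterDr.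
    apply: (@le_trans _ _ (F (m + n)%N x + F (m + n)%N y)).
      by rewrite /F -mulrDl ler_pM2r ?invr_gt0 //; exact: csnD.
    by apply: lerD; [rewrite addnC|]; exact: F_anti.
  + by move=> m n; exists (m + n)%N => x y; exact: FM.
  + move=> n; exists n => x; apply: (le_trans _ (F_anti n n _)).
    by rewrite /F csn_iter_mul // (csnX cp) expr_div_n exprD expr2.
  + by move=> x y; exists 0%N; rewrite /F /= (csnC cp) mul0r.
- move=> x; apply: ge_inf => //; exists 0%N => //.
  by rewrite /F /= expr0 divr1.
- move=> x; rewrite mulrC -ler_pdivlMr //; apply: ge_inf => //.
  by exists 1%N => //; rewrite /F /= expr1.
- move=> x H; have -> : range (F^~ x) = [set p x]; last exact: inf1.
  apply/seteqP; split=> [_ [n _ <-]|_ ->] /=.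
    by rewrite /F H mulrAC mulfV ?mul1r ?gt_eqF.
  by exists 0%N => //; rewrite /F /= expr0 divr1.
Qed.

Lemma minimal_cseminorm p0 k : cseminorm p0 ->
  exists p, [/\ cseminorm p, forall x, p x <= p0 x, p0 k <= p k &
    forall q, cseminorm q -> (forall x, q x <= p x) -> p0 k <= q k -> q = p].
Proof.
move=> cp0.
pose good p := [/\ cseminorm p, forall x, p x <= p0 x & p0 k <= p k].
pose T := {p | good p}.
(* Zorn's lemma yields maximal elements, so the pointwise order is reversed. *)
pose le (p q : T) := `[< forall x, sval q x <= sval p x >].
have good0 : good p0 by [].
have [||||[p gp] maxp] := @Zorn T le.
- by move=> t; apply/asboolP.
- move=> r s t /asboolP rs /asboolP st; apply/asboolP => x.
  exact: le_trans (st x) (rs x).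
- move=> [s gs] [t gt] /asboolP /= st /asboolP /= ts; apply: eq_exist.
  by apply/funext => x; apply/eqP; rewrite eq_le st ts.
- move=> Ch tot; have [[t0 Ct0]|no] := pselect (exists t, Ch t); last first.
    by exists (exist _ p0 good0) => s Cs; exfalso; apply: no; exists s.
  pose I := {t | Ch t}.
  pose F (i : I) := sval (sval i).
  have cF i : cseminorm (F i) by case: i => -[p [? ? ?]] ?.
  have F0 i x : 0 <= F i x by apply: csn_ge0.
  have dir (i j : I) : exists l, forall x, F l x <= F i x /\ F l x <= F j x.
    case: i j => [s Cs] [t Ct]; have [/asboolP st|/asboolP ts] := tot s t Cs Ct.
      by exists (exist _ t Ct) => x; split; [exact: st|exact: lexx].
    by exists (exist _ s Cs) => x; split; [exact: lexx|exact: ts].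
  pose i0 : I := exist _ t0 Ct0.
  have lb x : has_lbound (range (F^~ x)) by exists 0 => _ [j _ <-].
  pose m x := inf (range (F^~ x)).
  have gm : good m.
    split.
    + apply: inf_cseminorm => //.
      * by move=> i c x; exact: (csnZ (cF i)).
      * move=> i j; have [l Hl] := dir i j; exists l => x y.
        rewrite (le_trans (csnD (cF l) _ _)) // lerD //; [exact: (Hl x).1|exact: (Hl y).2].
      * move=> i j; have [l Hl] := dir i j; exists l => x y.
        rewrite (le_trans (csnM (cF l) _ _)) // ler_pM //; [exact: (Hl x).1|exact: (Hl y).2].
      * by move=> i; exists i => x; rewrite (csnX (cF i)).
      * by move=> x y; exists i0; exact: (csnC (cF i0)).
    + move=> x; apply: (@le_trans _ _ (F i0 x)); first by apply: ge_inf => //; exists i0.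
      by rewrite /F /=; case: (t0) => p [].
    + apply: lb_le_inf; first by exists (F i0 k), i0.
      by move=> _ [[[p [? ? ?]] ?] _ <-].
  exists (exist _ m gm) => s Cs; apply/asboolP => x /=; apply: ge_inf => //.
  by exists (exist _ s Cs).
exists p; case: (gp) => cp pp0 pk; split=> // q cq qp qk.
have gq : good q by split=> // x; exact: le_trans (qp x) (pp0 x).
have := maxp (exist _ q gq); have H : le (exist _ p gp) (exist _ q gq) by apply/asboolP.
by move=> /(_ H) [].
Qed.

(** Localizing a minimal [p] at [f] leaves it unchanged as soon as [p (f^n k) = p f ^+ n * p k] for
    all [n], and then [p f * p x <= p (f x)]. The condition holds first for [f = k];
    multiplicativity at [k] then gives it for every [f] with [p f > 0]. *)
Lemma multiplicative_cseminorm p0 k : cseminorm p0 -> 0 < p0 k ->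
  exists p, [/\ cseminorm p, forall x, p x <= p0 x, p k = p0 k &
    forall x y, p (mul x y) = p x * p y].
Proof.
move=> cp0 k0; have [p [cp pp0 pk minp]] := minimal_cseminorm k cp0.
have pk0 : 0 < p k by exact: lt_le_trans pk.
have ge0 := csn_ge0 cp.
have mulE f : 0 < p f -> (forall n, p (iter n (mul f) k) = p f ^+ n * p k) ->
    forall x, p (mul f x) = p f * p x.
  move=> f0 H x; have [q [cq qp qf qk]] := localize_cseminorm cp f0.
  have qE : q = p by apply: minp => //; rewrite qk.
  by apply/eqP; rewrite eq_le (csnM cp) /=; have := qf x; rewrite qE.
have mulk x : p (mul k x) = p k * p x.
  by apply: mulE => // n; rewrite csn_iter_self // exprSr.
exists p; split=> //; first by apply/eqP; rewrite eq_le pp0 pk.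
move=> f x; have [f0|f0] := eqVneq (p f) 0.
  apply/eqP; rewrite eq_le (csnM cp) f0 mul0r /=; exact: ge0.
have fpos : 0 < p f by rewrite lt0r f0 ge0.
apply: mulE => // n; have [->|] := posnP n; first by rewrite mul1r.
case: n => // n _.
have -> : p (iter n.+1 (mul f) k) = p (mul (iter n (mul f) f) k).
  by rewrite iter_mul_mul // iterSr.
by rewrite (null_eq cp (csnC cp _ _)) mulk csn_iter_self // mulrC.
Qed.

End Seminorms.

(** * The Gelfand-Mazur argument *)

Section RealLemmas.
Variable R : realType.
Implicit Types (r e b c d : R).

Lemma exp_lt_eps r e : 0 <= r -> r < 1 -> 0 < e ->
  exists n0, forall n, (n0 <= n)%N -> r ^+ n < e.
Proof.
move=> r0 r1 e0; have : `|r| < 1 by rewrite ger0_norm.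
move=> /cvg_expr /cvgrPdist_lt /(_ e e0) [n0 _ H]; exists n0 => n nn.
by have := H n nn; rewrite sub0r normrN ger0_norm // exprn_ge0.
Qed.

(** Taking [2^i]-th roots removes the constant [c] in the limit. Powers of two are the exponents
    that iterated squaring supplies. *)
Lemma le_of_exp_le b c d : 0 <= b -> 0 <= d ->
  (forall i, b ^+ (2 ^ i) <= c * d ^+ (2 ^ i)) -> b <= d.
Proof.
move=> b0 d0 H; rewrite leNgt; apply/negP => db.
have bpos : 0 < b by exact: le_lt_trans db.
have cpos : 0 < `|c| + 1 by rewrite ltr_wpDl.
have db1 : d / b < 1 by rewrite ltr_pdivrMr // mul1r.
have cV : 0 < (`|c| + 1)^-1 by rewrite invr_gt0.
have [n Hn] := exp_lt_eps (divr_ge0 d0 b0) db1 cV.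
have := H n; have := Hn (2 ^ n)%N (ltnW (ltn_expl _ (ltnSn 1))).
rewrite expr_div_n ltr_pdivrMr ?exprn_gt0 // ltr_pdivlMl // => H1 H2.
have := lt_le_trans H1 H2; rewrite ltNge => /negP; apply.
rewrite ler_wpM2r ?exprn_ge0 // (le_trans (ler_norm _)) // lerDl //.
Qed.

(** Each step multiplies the coefficient [t = 3 ^+ n] of [r] by at most 3, as [1 + t + t r <= 3 t]
    for [t >= 1] and [r <= 1]. *)
Lemma expD1_le r n : 0 <= r -> r <= 1 -> (1 + r) ^+ n <= 1 + 3 ^+ n * r.
Proof.
move=> r0 r1; elim: n => [|n IH]; first by rewrite !expr0; lra.
rewrite exprS; apply: (@le_trans _ _ ((1 + r) * (1 + 3 ^+ n * r))).
  by rewrite ler_wpM2l // addr_ge0.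
have : 1 <= (3 : R) ^+ n by rewrite exprn_ege1 //; lra.
rewrite exprS; move: (3 ^+ n) => t t1.
have h1 : 0 <= (t - 1) * r by rewrite mulr_ge0 // subr_ge0.
have h2 : 0 <= t * r * (1 - r).
  by rewrite !mulr_ge0 ?subr_ge0 //; exact: le_trans t1.
by lra.
Qed.

Lemma normc_ge0 (z : R[i]) : 0 <= normc z.
Proof. by case: z => a b; exact: sqrtr_ge0. Qed.

Lemma normcR r : normc r%:C%C = `|r|.
Proof. by rewrite /= expr0n addr0 sqrtr_sqr. Qed.

Lemma ler_Re_normc (z : R[i]) : `|complex.Re z| <= normc z.
Proof.
case: z => a b /=; rewrite -sqrtr_sqr ler_wsqrtr // lerDl; exact: sqr_ge0.
Qed.

Lemma ler_Im_normc (z : R[i]) : `|complex.Im z| <= normc z.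
Proof.
case: z => a b /=; rewrite -sqrtr_sqr ler_wsqrtr // lerDr; exact: sqr_ge0.
Qed.

Lemma normc_le_ReIm (z : R[i]) : normc z <= `|complex.Re z| + `|complex.Im z|.
Proof.
case: z => a b /=; rewrite -(ler_pXn2r (_ : 0 < 2)%N) ?nnegrE ?sqrtr_ge0 ?addr_ge0 //.
rewrite sqr_sqrtr ?addr_ge0 ?sqr_ge0 // sqrrD !real_normK ?num_real //.
by rewrite -addrA lerD2l lerDr mulrn_wge0 // mulr_ge0.
Qed.

Lemma normcX (z : R[i]) n : normc (z ^+ n) = normc z ^+ n.
Proof. by elim: n => [|n IH]; rewrite ?normc1 // !exprS normcM IH. Qed.

End RealLemmas.

Section GelfandMazur.
Variables (R : realType) (V : lmodType R[i]) (mul : V -> V -> V).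
Hypothesis mulA : forall x y z, mul x (mul y z) = mul (mul x y) z.
Hypothesis mulDl : forall x y z, mul (x + y) z = mul x z + mul y z.
Hypothesis mulDr : forall x y z, mul x (y + z) = mul x y + mul x z.
Hypothesis mulZl : forall (c : R[i]) x y, mul (c *: x) y = c *: mul x y.
Hypothesis mulZr : forall (c : R[i]) x y, mul x (c *: y) = c *: mul x y.

Section Multiplicative.
Variables (p : V -> R) (cp : cseminorm mul p).
Hypothesis pM : forall x y, p (mul x y) = p x * p y.
Variable k : V.
Hypothesis k0 : 0 < p k.

(* [N x a] plays the role of [p (x + a)] in a unitization. *)
Let N x (a : R[i]) := p (mul x k + a *: k) / p k.

Let N_ge0 x a : 0 <= N x a.
Proof. by rewrite divr_ge0 ?(csn_ge0 cp) // ltW. Qed.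

Let N_shift x a b : N x (a + b) <= N x a + normc b.
Proof.
rewrite /N ler_pdivrMr // mulrDl mulfVK ?gt_eqF // -(csnZ cp) scalerDl addrA.
exact: (csnD cp).
Qed.

Let N_dist x a b : normc (a - b) <= N x a + N x b.
Proof.
rewrite /N -mulrDl ler_pdivlMr // -(csnZ cp) scalerBl -(subrKA (- mul x k)) opprK.
by rewrite addrC -opprD addrC [a *: k + _]addrC; exact: (csnB cp).
Qed.

(** This is [(x + a)^2 - s^2 = (x + a - s)(x + a + s)] in the unitization; a second factor [k] makes
    both sides products in [V]. *)
Let N_sqr x a s : N (mul x x + (2 * a) *: x) (a ^+ 2 - s ^+ 2) = N x (a - s) * N x (a + s).
Proof.
have pk : p k != 0 by rewrite gt_eqF.
rewrite /N; set X := _ + _ *: k.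
suff H : p X * p k = p (mul x k + (a - s) *: k) * p (mul x k + (a + s) *: k).
  by rewrite mulrACA -invfM -H; field.
rewrite -!pM {}/X.
set u := mul x k + (a - s) *: k.
have -> : mul (mul (mul x x + (2 * a) *: x) k + (a ^+ 2 - s ^+ 2) *: k) k =
          mul (mul x u) k + (a + s) *: mul u k.
  rewrite /u !(mulDl, mulDr, mulZl, mulZr) !mulA -!addrA; congr (_ + _).
  rewrite scalerDr scalerA addrA -scalerDl; congr (_ *: _ + _ *: _); ring.
have -> : mul u (mul x k + (a + s) *: k) = mul (mul u x) k + (a + s) *: mul u k.
  by rewrite mulDr mulZr mulA.
apply: (null_eq cp); rewrite /nullv opprD addrACA subrr addr0.
by apply: (null_mulr mulDl mulZl cp); exact: (csnC cp).
Qed.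

(** Squaring in the unitization, with [(x, a)] for [x + a]; thus [pow2 i x a] is [(x + a)^(2^i)]. *)
Let sqr (u : V * R[i]) := (mul u.1 u.1 + (2 * u.2) *: u.1, u.2 ^+ 2).
Let pow2 i x a := iter i sqr (x, a).

(** Complex square roots split [(x + a)^(2^i) - z] into [2^i] factors [x + b], each of size at least
    [m]. *)
Let pow2_lower m x a i (z : R[i]) : 0 <= m -> (forall b, m <= N x b) ->
  m ^+ (2 ^ i) <= N (pow2 i x a).1 ((pow2 i x a).2 - z).
Proof.
move=> m0 mN; elim: i z => [|i IH] z; first by rewrite expr1.
rewrite /pow2 iterS -/(pow2 _ _ _) /= -(sqr_sqrtc z) N_sqr.
rewrite expnSr exprM expr2 ler_pM ?exprn_ge0 //.
by rewrite -[sqrtc z]opprK; exact: IH.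
Qed.

Let pow2_upper x a i : N (pow2 i x a).1 (pow2 i x a).2 = N x a ^+ (2 ^ i).
Proof.
elim: i => [|i IH]; first by rewrite expr1.
rewrite /pow2 iterS -/(pow2 _ _ _) /= -[X in N _ X]subr0.
have -> : (0 : R[i]) = 0 ^+ 2 by rewrite expr0n.
by rewrite N_sqr subr0 addr0 IH expnSr exprM expr2.
Qed.

(** For [y = x + a], [y^(2^i) - z^(2^i)] is [y - z] times the factors [y^(2^j) + z^(2^j)] with
    [j < i], whose lower bounds multiply to [m^(2^i - 1)]. *)
Let pow2_chain m x a i (z : R[i]) : 0 <= m -> (forall b, m <= N x b) ->
  N x (a - z) * m ^+ (2 ^ i) <= m * N (pow2 i x a).1 ((pow2 i x a).2 - z ^+ (2 ^ i)).
Proof.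
move=> m0 mN; elim: i => [|i IH]; first by rewrite !expr1 mulrC.
rewrite /pow2 iterS -/(pow2 _ _ _) /= expnSr !exprM N_sqr expr2 [leLHS]mulrA [leRHS]mulrA.
have mi0 : 0 <= m ^+ (2 ^ i) by exact: exprn_ge0.
apply: ler_pM => //; first exact: mulr_ge0.
by have := pow2_lower a i (- z ^+ (2 ^ i)) m0 mN; rewrite opprK.
Qed.

Let N_near m x a i (z : R[i]) : 0 <= m -> (forall b, m <= N x b) ->
  N x (a - z) * m ^+ (2 ^ i) <= m * (N x a ^+ (2 ^ i) + normc z ^+ (2 ^ i)).
Proof.
move=> m0 mN; apply: le_trans (pow2_chain a i z m0 mN) _.
rewrite ler_wpM2l // (le_trans (N_shift _ _ _)) // pow2_upper lerD2l.
by rewrite normcN normcX.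
Qed.

(* If [m] were positive, near-minimality of [N x] at [a] would propagate to
   [a - m/2], hence arbitrarily far from [a]; this contradicts [N_dist]. *)
Let N_step m x : 0 < m -> (forall b, m <= N x b) -> forall d, 0 < d ->
  exists2 d', 0 < d' & forall a, N x a <= m * (1 + d') ->
    N x (a - (m / 2)%:C%C) <= m * (1 + d).
Proof.
move=> m0 mN d d0; have d20 : 0 < d / 2 by lra.
have [n Hn] := @exp_lt_eps R (1 / 2) (d / 2) ltac:(lra) ltac:(lra) d20.
have {}Hn : (1 / 2 : R) ^+ (2 ^ n) <= d / 2.
  by apply/ltW/Hn/ltnW/ltn_expl.
set M := (2 ^ n)%N in Hn.
have t0 : 0 < (3 : R) ^+ M by rewrite exprn_gt0 //; lra.
(* Half of the margin [d] covers [(1/2)^M], the other half [(1 + d')^M - 1], which [expD1_le] bounds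
   by [3^M d']. *)
pose d' := Num.min 1 (d / 2 / 3 ^+ M).
have d'0 : 0 < d' by rewrite lt_min ltr01 divr_gt0.
exists d' => // a Na.
have H1 : (1 + d') ^+ M <= 1 + d / 2.
  rewrite (le_trans (expD1_le _ (ltW d'0) _)) ?ge_min ?lexx // lerD2l.
  by rewrite mulrC -ler_pdivlMr // ge_min lexx orbT.
have mM : 0 < m ^+ M by exact: exprn_gt0.
rewrite -(ler_pM2r mM) (le_trans (N_near _ _ _ (ltW m0) mN)) // -mulrA ler_pM2l //.
rewrite normcR ger0_norm; last by lra.
have H2 : N x a ^+ M <= m ^+ M * (1 + d / 2).
  apply: (@le_trans _ _ ((m * (1 + d')) ^+ M)).
    by rewrite lerXn2r // nnegrE // mulr_ge0 // ?addr_ge0 // ltW.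
  by rewrite exprMn ler_pM2l.
have H3 : (m / 2) ^+ M <= m ^+ M * (d / 2).
  by rewrite exprMn ler_pM2l //; move: Hn; rewrite mul1r.
rewrite -/M; move: (_ ^+ M) (_ ^+ M) (m ^+ M) H2 H3 => t u v; lra.
Qed.

Let N_inf0 x : inf (range (N x)) = 0.
Proof.
set m := inf _.
have lb : has_lbound (range (N x)) by exists 0 => _ [b _ <-].
have mN b : m <= N x b by apply: ge_inf => //; exists b.
have m0 : 0 <= m by apply: lb_le_inf => [|_ [b _ <-]] //; exists (N x 0), 0.
apply/eqP; case: eqP => // /eqP mn0; exfalso.
have {mn0}m0 : 0 < m by rewrite lt0r mn0.
(* Ten steps of length [m/2] move [a] by [5m], while [N_dist] allows at most [2m + 2m]. *)
have [d' d'0 H] : exists2 d', 0 < d' & forall a, N x a <= m * (1 + d') ->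
    N x (a - 10 * (m / 2)%:C%C) <= m * (1 + 1).
  suff : forall K d, 0 < d -> exists2 d', 0 < d' & forall a, N x a <= m * (1 + d') ->
    N x (a - K%:R * (m / 2)%:C%C) <= m * (1 + d) by move=> /(_ 10%N); apply.
  elim=> [|K IH] d d0; first by exists d => // a; rewrite mul0r subr0.
  have [d1 d10 H1] := N_step m0 mN d0.
  have [d2 d20 H2] := IH _ d10; exists d2 => // a /H2/H1.
  by rewrite -[K.+1]addn1 natrD mulrDl mul1r opprD addrA.
pose e := Num.min 1 d'.
have e0 : 0 < m * e by rewrite mulr_gt0 // lt_min ltr01.
have hi : has_inf (range (N x)) by split=> //; exists (N x 0), 0.
have [_ [a _ <-] Ha] := inf_adherent e0 hi.
have {}Ha : N x a <= m * (1 + e) by rewrite mulrDr mulr1 ltW.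
have h1 : N x a <= m * (1 + d').
  by rewrite (le_trans Ha) // ler_pM2l // lerD2l ge_min lexx orbT.
have h2 : N x a <= m * 2.
  by rewrite (le_trans Ha) // ler_pM2l // -[2]/(1 + 1) lerD2l ge_min lexx.
have := N_dist x a (a - 10 * (m / 2)%:C%C).
rewrite opprB addrCA subrr addr0 normcM normcR ger0_norm; last by lra.
have -> : normc (10 : R[i]) = 10.
  by rewrite -[10 : R[i]](rmorph_nat (real_complex R)) normcR ger0_norm.
by have := H a h1; lra.
Qed.

(** The infimum is attained: by [N_dist] the intervals of radius [N x a] about [Re a] meet pairwise
    and so share a point [r1], and likewise [r2] for imaginary parts. Then [z] is within [2 N x a]
    of every [a], so [N x z <= 3 N x a]. *)
Let N_zero x : exists a, N x a = 0.
Proof.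
have key (f : R[i] -> R) : (forall a b, f a - f b = f (a - b)) ->
    (forall z, `|f z| <= normc z) -> exists r, forall a, `|f a - r| <= N x a.
  move=> fB fn; pose E := range (fun a => f a - N x a).
  have ubE b : ubound E (f b + N x b).
    move=> _ [a _ <-]; rewrite lerBlDr -addrA [N x b + _]addrC -lerBlDl fB.
    by rewrite (le_trans (ler_norm _)) // (le_trans (fn _)).
  have ne : E !=set0 by exists (f 0 - N x 0), 0.
  exists (sup E) => a; rewrite ler_distlC; apply/andP; split.
    by apply: sup_upper_bound; [split=> //; exists (f 0 + N x 0)|exists a].
  exact: ge_sup.
have [r1 H1] : exists r, forall a, `|complex.Re a - r| <= N x a.
  by apply: key; [case=> ? ? [? ?]|exact: ler_Re_normc].
have [r2 H2] : exists r, forall a, `|complex.Im a - r| <= N x a.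
  by apply: key; [case=> ? ? [? ?]|exact: ler_Im_normc].
pose z := Complex r1 r2; exists z; apply/eqP; rewrite eq_le N_ge0 andbT.
suff : N x z / 3 <= inf (range (N x)) by rewrite N_inf0; lra.
apply: lb_le_inf; first by exists (N x 0), 0.
move=> _ [a _ <-]; have := N_shift x a (z - a); rewrite addrCA subrr addr0 => H.
have := normc_le_ReIm (z - a).
have := H1 a; have := H2 a; rewrite distrC => h2; rewrite distrC => h1.
have -> : complex.Re (z - a) = r1 - complex.Re a by case: (a).
have -> : complex.Im (z - a) = r2 - complex.Im a by case: (a).
by lra.
Qed.

(** [phi x] is the scalar by which [x] acts on [k] modulo the kernel of [p]. *)
Lemma character_of_multiplicative : exists phi : V -> R[i],
  [/\ forall x y, phi (x + y) = phi x + phi y,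
      forall c x, phi (c *: x) = c * phi x,
      forall x y, phi (mul x y) = phi x * phi y &
      forall x, normc (phi x) = p x].
Proof.
have H x : exists a, p (mul x k - a *: k) = 0.
  have [a Na] := N_zero x; exists (- a); rewrite scaleNr opprK.
  by move/eqP: Na; rewrite /N mulf_eq0 invr_eq0 (gt_eqF k0) orbF => /eqP.
have [phi Hphi] := choice H; exists phi.
have uniq x a : p (mul x k - a *: k) = 0 -> phi x = a.
  move=> Ha; apply/eqP; rewrite -subr_eq0; apply/eqP/eq0_normc/eqP.
  suff : normc (phi x - a) * p k == 0 by rewrite mulf_eq0 (gt_eqF k0) orbF.
  rewrite -(csnZ cp) scalerBl eq_le (csn_ge0 cp) andbT.
  have -> : phi x *: k - a *: k = (mul x k - a *: k) - (mul x k - phi x *: k).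
    by rewrite opprB [RHS]addrC subrKA.
  by rewrite (le_trans (csnB cp _ _)) // Ha Hphi addr0.
split.
- move=> x y; apply: uniq; rewrite mulDl scalerDl opprD addrACA.
  apply/eqP; rewrite eq_le (csn_ge0 cp) andbT.
  by rewrite (le_trans (csnD cp _ _)) // !Hphi addr0.
- by move=> c x; apply: uniq; rewrite mulZl -scalerA -scalerBr (csnZ cp) Hphi mulr0.
- move=> x y; apply: uniq.
  have -> : mul (mul x y) k - (phi x * phi y) *: k =
      mul x (mul y k - phi y *: k) + phi y *: (mul x k - phi x *: k).
    rewrite -[X in mul x (_ + X)]scaleNr mulDr !mulZr scaleNr mulA scalerBr scalerA.
    by rewrite addrA subrK [phi x * _]mulrC.
  apply/eqP; rewrite eq_le (csn_ge0 cp) andbT.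
  by rewrite (le_trans (csnD cp _ _)) // (csnZ cp) pM !Hphi !mulr0 addr0.
- move=> x; apply: (mulIf (_ : p k != 0)); first by rewrite gt_eqF.
  by rewrite -(csnZ cp) -pM; apply/esym/(null_eq cp); exact: Hphi.
Qed.

End Multiplicative.

Lemma exists_character p k : cseminorm mul p -> 0 < p k ->
  exists phi : V -> R[i],
  [/\ forall x y, phi (x + y) = phi x + phi y,
      forall c x, phi (c *: x) = c * phi x,
      forall x y, phi (mul x y) = phi x * phi y,
      forall x, normc (phi x) <= p x &
      normc (phi k) = p k].
Proof.
move=> cp k0.
have [q [cq qp qk qM]] := multiplicative_cseminorm mulA mulDl mulDr mulZl mulZr cp k0.
have q0 : 0 < q k by rewrite qk.
have [phi [? ? ? phiq]] := character_of_multiplicative cq qM q0.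
by exists phi; split=> // [x|]; rewrite phiq.
Qed.

End GelfandMazur.

(** * Polynomial functional calculus *)

Section Norm.
Variables (R : realType) (A : cstar_algebra R).

Local Notation "x ** y" := (@cs_mul R A x y) (at level 40, left associativity).
Local Notation star := (@cs_star R A).

Implicit Types x y z h : A.

Lemma csstarK x : star (star x) = x.
Proof. exact: (cs_starK (@cs_ax R A)). Qed.

Lemma csstarD x y : star (x + y) = star x + star y.
Proof. exact: (cs_starD (@cs_ax R A)). Qed.

Lemma csstarZ (c : R[i]) x : star (c *: x) = (c^*)%C *: star x.
Proof. exact: (cs_starZ (@cs_ax R A)). Qed.

Lemma csstarM x y : star (x ** y) = star y ** star x.
Proof. exact: (cs_starM (@cs_ax R A)). Qed.

Lemma csstar0 : star 0 = 0.
Proof. by have := csstarZ 0 0; rewrite conjc0 !scale0r. Qed.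

(** The norm of [A] has values in [R[i]]; they are nonnegative, so the real part loses nothing. *)
Definition nrm x : R := complex.Re `|x|.

Lemma nrmE x : `|x| = (nrm x)%:C%C.
Proof. by rewrite /nrm RRe_real // ger0_real. Qed.

Lemma nrm_ge0 x : 0 <= nrm x.
Proof. by rewrite -ler0c -nrmE. Qed.

Lemma nrm0 : nrm 0 = 0.
Proof. by rewrite /nrm normr0. Qed.

Lemma nrm_eq0 x : nrm x = 0 -> x = 0.
Proof. by move=> x0; apply/eqP; rewrite -normr_eq0 nrmE x0. Qed.

Lemma nrmD x y : nrm (x + y) <= nrm x + nrm y.
Proof. by rewrite -lecR rmorphD /= -!nrmE; exact: ler_normD. Qed.

Lemma nrmZ (c : R[i]) x : nrm (c *: x) = normc c * nrm x.
Proof. by apply: complexI; rewrite rmorphM /= -!nrmE normrZ. Qed.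

Lemma nrmN x : nrm (- x) = nrm x.
Proof. by rewrite /nrm normrN. Qed.

Lemma nrmB x y : nrm (x - y) <= nrm x + nrm y.
Proof. by rewrite -(nrmN y); exact: nrmD. Qed.

Lemma nrmM x y : nrm (x ** y) <= nrm x * nrm y.
Proof. by rewrite -lecR rmorphM /= -!nrmE; exact: (cs_norm_mul (@cs_ax R A)). Qed.

Lemma nrm_starl x : nrm (star x ** x) = nrm x ^+ 2.
Proof. by apply: complexI; rewrite rmorphXn /= -!nrmE; exact: (cs_cstar (@cs_ax R A)). Qed.

Lemma nrm_star x : nrm (star x) = nrm x.
Proof.
suff H y : nrm y <= nrm (star y).
  by apply/eqP; rewrite eq_le H andbT -{2}(csstarK x).
have [->|y0] := eqVneq (nrm y) 0; first exact: nrm_ge0.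
have ypos : 0 < nrm y by rewrite lt0r y0 nrm_ge0.
by rewrite -(ler_pM2r ypos) -expr2 -nrm_starl nrmM.
Qed.

Lemma nrm_starr x : nrm (x ** star x) = nrm x ^+ 2.
Proof. by rewrite -{1}(csstarK x) nrm_starl nrm_star. Qed.

Record cstar_seminorm (q : A -> R) : Prop := CStarSeminorm {
  cqD : forall x y, q (x + y) <= q x + q y;
  cqZ : forall (c : R[i]) x, q (c *: x) = normc c * q x;
  cqM : forall x y, q (x ** y) <= q x * q y;
  cqS : forall x, q (x ** star x) = q x ^+ 2
}.

Lemma nrm_cstar_seminorm : cstar_seminorm nrm.
Proof.
by split; [exact: nrmD|exact: nrmZ|exact: nrmM|exact: nrm_starr].
Qed.

Lemma cq_ge0 q x : cstar_seminorm q -> 0 <= q x.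
Proof.
move=> cq; have := cqD cq x (- x); rewrite -{2}scaleN1r (cqZ cq) normcN normc1 mul1r.
rewrite subrr -mulr2n -(scale0r 0) (cqZ cq) normc0 mul0r.
by rewrite pmulrn_lge0.
Qed.

(** [q (x x) ^+ 2] is the value at [x x (star x) (star x)]. Normality modulo [q] replaces this
    element by the square of [x (star x)], where [q] is [q x ^+ 4]. *)
Lemma cq_normal_sqr q x : cstar_seminorm q -> q (x ** star x - star x ** x) = 0 ->
  q (x ** x) = q x ^+ 2.
Proof.
move=> cq nx; have q0 y : 0 <= q y by exact: cq_ge0.
apply/eqP; rewrite -(eqrXn2 (_ : 0 < 2)%N) ?exprn_ge0 //; apply/eqP.
rewrite -(cqS cq (x ** x)) csstarM.
pose u := x ** star x.
have su : star u = u by rewrite /u csstarM csstarK.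
have -> : (q x ^+ 2) ^+ 2 = q (u ** u) by rewrite -{2}su !(cqS cq).
have qle y z : q (y - z) = 0 -> q y <= q z.
  by move=> yz; rewrite -(subrK z y) (le_trans (cqD cq _ _)) // yz add0r.
have qN y : q (- y) = q y by rewrite -scaleN1r (cqZ cq) normcN normc1 mul1r.
set a := _ ** _ ** _.
have d0 : q (a - u ** u) = 0.
  have -> : a - u ** u = x ** (x ** star x - star x ** x) ** star x.
    by rewrite /a /u csmulBr csmulBl !csmulA.
  apply/eqP; rewrite eq_le q0 andbT (le_trans (cqM cq _ _)) //.
  have -> : q (x ** (x ** star x - star x ** x)) = 0; last by rewrite mul0r.
  by apply/eqP; rewrite eq_le q0 andbT (le_trans (cqM cq _ _)) // nx mulr0.
by apply/eqP; rewrite eq_le !qle // -qN opprB.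
Qed.

End Norm.

Section PolynomialCalculus.
Variables (R : realType) (A : cstar_algebra R) (h : A).

Local Notation "x ** y" := (@cs_mul R A x y) (at level 40, left associativity).
Local Notation star := (@cs_star R A).
Local Notation C := (R[i]).

Implicit Types (x y z : A) (F G : {poly C}) (f g : {poly R}).

(* Left multiplication by [F(h)], computed in the unitization. *)
Definition act F y : A := \sum_(i < size F) F`_i *: iter i (fun z => h ** z) y.

Lemma act_widen n F y : (size F <= n)%N ->
  act F y = \sum_(i < n) F`_i *: iter i (fun z => h ** z) y.
Proof.
move=> Fn; rewrite /act (big_ord_widen n (fun i => F`_i *: iter i (fun z => h ** z) y)) //.
rewrite big_mkcond; apply: eq_bigr => i _; case: ltnP => // Fi.
by rewrite nth_default // scale0r.
Qed.

Lemma actD F G y : act (F + G) y = act F y + act G y.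
Proof.
have [m FGm] : exists m, [/\ size F <= m, size G <= m & size (F + G)%R <= m]%N.
  exists (maxn (size F) (size G)); split; rewrite ?leq_maxl ?leq_maxr //.
  exact: size_polyD.
case: FGm => Fm Gm FGm; rewrite !(act_widen _ Fm, act_widen _ Gm, act_widen _ FGm).
by rewrite -big_split; apply: eq_bigr => i _; rewrite coefD scalerDl.
Qed.

Lemma actZ (c : C) F y : act (c *: F) y = c *: act F y.
Proof.
rewrite (act_widen _ (size_scale_leq c F)) scaler_sumr; apply: eq_bigr => i _.
by rewrite coefZ scalerA.
Qed.

Lemma act0 y : act 0 y = 0.
Proof. by rewrite /act size_poly0 big_ord0. Qed.

Lemma actB F G y : act (F - G) y = act F y - act G y.
Proof. by rewrite actD -scaleN1r actZ scaleN1r. Qed.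

Lemma actC (c : C) y : act c%:P y = c *: y.
Proof. by rewrite (act_widen _ (size_polyC_leq1 c)) big_ord1 coefC. Qed.

Lemma act1 y : act 1 y = y.
Proof. by rewrite -[1]/(1%:P) actC scale1r. Qed.

Lemma act_mulX F y : act (F * 'X) y = act F (h ** y).
Proof.
have sF : (size (F * 'X)%R <= (size F).+1)%N.
  by rewrite (leq_trans (size_polyMleq _ _)) // size_polyX addn2.
rewrite (act_widen _ sF) big_ord_recl coefMX /= scale0r add0r.
by apply: eq_bigr => i _; rewrite coefMX /= -iterSr.
Qed.

Lemma act_mulX_polyC F (c : C) y : act (F * 'X + c%:P) y = act F (h ** y) + c *: y.
Proof. by rewrite actD act_mulX actC. Qed.

Lemma act_mulr F y z : act F (y ** z) = act F y ** z.
Proof.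
elim/poly_ind: F y => [|F c IH] y; first by rewrite !act0 csmul0l.
by rewrite !act_mulX_polyC csmulA IH csmulDl csmulZl.
Qed.

Lemma act_mulh F y : act F (h ** y) = h ** act F y.
Proof.
elim/poly_ind: F y => [|F c IH] y; first by rewrite !act0 csmul0r.
by rewrite !act_mulX_polyC csmulDr csmulZr IH.
Qed.

Lemma act_addr F y z : act F (y + z) = act F y + act F z.
Proof.
elim/poly_ind: F y z => [|F c IH] y z; first by rewrite !act0 addr0.
by rewrite !act_mulX_polyC csmulDr IH scalerDr addrACA.
Qed.

Lemma actX y : act 'X y = h ** y.
Proof. by rewrite -['X]mul1r act_mulX act1. Qed.

Lemma actM F G y : act (F * G) y = act F (act G y).
Proof.
elim/poly_ind: F y => [|F c IH] y; first by rewrite mul0r !act0.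
rewrite mulrDl actD mulrAC act_mulX IH act_mulX_polyC act_mulh.
by rewrite mul_polyC actZ.
Qed.

Lemma actM_mul F G : act (F * 'X * G) h = act F h ** act G h.
Proof. by rewrite actM act_mulX act_mulr. Qed.

Lemma act_ideal (J : set A) F : ideal J -> (forall (c : C) x, J x -> J (c *: x)) ->
  forall y, J y -> J (act F y).
Proof.
move=> [JG JM] JZ; elim/poly_ind: F => [|F c IH] y Jy.
  by rewrite act0; exact: subgroup0.
rewrite act_mulX_polyC; apply: (subgroupD JG); last exact: JZ.
by apply: IH; exact: (JM h y Jy).1.
Qed.

Hypothesis sah : star h = h.

Lemma star_iter i : star (iter i (fun z => h ** z) h) = iter i (fun z => h ** z) h.
Proof.
elim: i => //= i IH; rewrite csstarM IH sah.
by elim: i {IH} => //= i IH; rewrite -csmulA IH.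
Qed.

Lemma star_act_self F : star (act F h) = act (map_poly conjc F) h.
Proof.
rewrite (@act_widen (size F) (map_poly _ _)) ?size_poly //.
rewrite /act (big_morph star (@csstarD _ A) (@csstar0 _ A)).
by apply: eq_bigr => i _; rewrite csstarZ star_iter coef_map.
Qed.

(** [F(h)] belongs to the unitization only, so its adjoint is expressed by moving it across a
    product. *)
Lemma star_act F y w : star (act F y) ** w = star y ** act (map_poly conjc F) w.
Proof.
elim/poly_ind: F y w => [|F c IH] y w.
  by rewrite rmorph0 !act0 csstar0 csmul0l csmul0r.
rewrite rmorphD rmorphM /= map_polyX map_polyC !act_mulX_polyC.
rewrite csstarD csstarZ csmulDl csmulDr csmulZl csmulZr IH csstarM sah.
by rewrite -csmulA act_mulh.
Qed.

Lemma nrm_act_sqr F y : nrm (act F y) ^+ 2 <= nrm y * nrm (act (map_poly conjc F * F) y).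
Proof. by rewrite -nrm_starl star_act -actM (le_trans (nrmM _ _)) // nrm_star. Qed.

(** [act F h] is [h F(h)], so [F] stands for the polynomial ['X * F] without constant term;
    multiplying two of these corresponds to [pmul]. *)
Definition pmul F G := F * 'X * G.

Lemma cseminorm_act : @cseminorm R {poly C} pmul (fun F => nrm (act F h)).
Proof.
split.
- by move=> F G; rewrite actD; exact: nrmD.
- by move=> c F; rewrite actZ nrmZ.
- by move=> F G; rewrite /pmul actM_mul; exact: nrmM.
- move=> F; rewrite /pmul actM_mul; apply: cq_normal_sqr.
    exact: nrm_cstar_seminorm.
  by rewrite star_act_self -!actM_mul -actB (_ : _ - _ = 0) ?act0 ?nrm0 //; ring.
- by move=> F G; rewrite /pmul (_ : _ - _ = 0) ?act0 ?nrm0 //; ring.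
Qed.

Let toC := map_poly (real_complex R).

Lemma conj_toC f : map_poly conjc (toC f) = toC f.
Proof. by apply/polyP => i; rewrite !coef_map /= oppr0. Qed.

(** For self-adjoint [h] and real [s], the adjoint of [h + is] times [h + is] is [h^2 + s^2]. *)
Lemma nrm_act_Xi (s : R) y :
  nrm (act ('X + (Complex 0 s)%:P) y) <= Num.sqrt (nrm h ^+ 2 + s ^+ 2) * nrm y.
Proof.
have r0 : 0 <= nrm h ^+ 2 + s ^+ 2 by rewrite addr_ge0 // sqr_ge0.
rewrite -(ler_pXn2r (_ : 0 < 2)%N) ?nnegrE ?mulr_ge0 ?sqrtr_ge0 ?nrm_ge0 //.
rewrite exprMn sqr_sqrtr // (le_trans (nrm_act_sqr _ _)) //.
rewrite expr2 mulrCA ler_wpM2l ?nrm_ge0 //.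
have -> : map_poly conjc ('X + (Complex 0 s)%:P) * ('X + (Complex 0 s)%:P) =
    'X * 'X + ((s ^+ 2)%:C%C)%:P :> {poly C}.
  rewrite rmorphD /= map_polyX map_polyC /= mulrDl !mulrDr -!addrA; congr (_ + _).
  rewrite addrA ['X * _]mulrC -mulrDl -polyCM -polyCD.
  have -> : Complex 0 s + Complex (0 : R) (- s) = 0 by rewrite -[LHS]/(Complex _ _) addr0 subrr.
  rewrite mul0r add0r; congr (_ %:P); apply/eqP; rewrite eq_complex /=.
  by apply/andP; split; apply/eqP; ring.
rewrite actD actC actM !actX mulrDl (le_trans (nrmD _ _)) // lerD //.
  rewrite (le_trans (nrmM _ _)) // -mulrA ler_wpM2l ?nrm_ge0 //; exact: nrmM.
by rewrite nrmZ normcR ger0_norm ?sqr_ge0.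
Qed.

Lemma nrm_act_Xi_exp (s : R) n y : nrm (act (('X + (Complex 0 s)%:P) ^+ n) y) <=
  Num.sqrt (nrm h ^+ 2 + s ^+ 2) ^+ n * nrm y.
Proof.
elim: n => [|n IH]; first by rewrite !expr0 act1 mul1r.
rewrite exprS actM (le_trans (nrm_act_Xi _ _)) // (exprS _ n) -mulrA.
by rewrite ler_wpM2l ?sqrtr_ge0.
Qed.

(** A character of [pmul] attaining the norm at [f] has the form [F |-> l F(l)] with [l = phi 1].
    Testing it on [('X + is)^(2^i)] gives [|l + is|^2 <= |h|^2 + s^2] for all real [s], so [l] is
    real with [|l| <= |h|]. *)
Lemma nrm_act_self_le f (M : R) :
  (forall t, `|t| <= nrm h -> `|t * f.[t]| <= M) -> nrm (act (toC f) h) <= M.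
Proof.
move=> fM.
have M0 : 0 <= M by have := fM 0; rewrite normr0 mul0r normr0; apply; exact: nrm_ge0.
have [->//|k0] := eqVneq (nrm (act (toC f) h)) 0.
have kpos : 0 < nrm (act (toC f) h) by rewrite lt0r k0 nrm_ge0.
have [|||||phi [phiD phiZ phiM phile phik]] :=
  exists_character _ _ _ _ _ cseminorm_act kpos.
- by move=> x y z; rewrite /pmul !mulrA.
- by move=> x y z; rewrite /pmul !mulrDl.
- by move=> x y z; rewrite /pmul !mulrDr.
- by move=> c x y; rewrite /pmul -!scalerAl.
- by move=> c x y; rewrite /pmul -!scalerAr.
pose l := phi 1.
have phi0 : phi 0 = 0 by have := phiZ 0 0; rewrite scale0r mul0r.
have phiE F : phi F = l * F.[l].
  elim/poly_ind: F => [|F c IH]; first by rewrite phi0 horner0 mulr0.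
  rewrite phiD hornerMXaddC -[F * 'X]mulr1 -/(pmul F 1) phiM IH -/l.
  by rewrite -alg_polyC phiZ -/l; ring.
have l0 : l != 0.
  by apply: contra k0 => /eqP l0; rewrite -phik phiE l0 mul0r normc0.
have lpos : 0 < normc l by rewrite lt0r normc_ge0 andbT; apply: contra l0 => /eqP/eq0_normc ->.
have bound (s : R) : normc (l + Complex 0 s) <= Num.sqrt (nrm h ^+ 2 + s ^+ 2).
  apply: (@le_of_exp_le _ _ (nrm h / normc l)) => [||i];
    [exact: normc_ge0|exact: sqrtr_ge0|].
  rewrite mulrAC ler_pdivlMr // mulrC.
  apply: le_trans (le_trans (phile (('X + (Complex 0 s)%:P) ^+ (2 ^ i))) _).
    by rewrite phiE normcM horner_exp hornerD hornerX hornerC normcX mulrC.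
  by rewrite mulrC; exact: nrm_act_Xi_exp.
have sq_bound s : complex.Re l ^+ 2 + (complex.Im l + s) ^+ 2 <= nrm h ^+ 2 + s ^+ 2.
  rewrite -ler_sqrt ?addr_ge0 ?sqr_ge0 //; have := bound s.
  by case: (l) => a b /=; rewrite addr0.
have lIm : complex.Im l = 0.
  apply/eqP; case: eqP => // /eqP b0.
  (* This [s] makes the cross term [2 s Im l] equal to [|h|^2 + 1], which exceeds the bound. *)
  have := sq_bound ((nrm h ^+ 2 + 1) / (2 * complex.Im l)).
  have := sqr_ge0 (complex.Re l); have := sqr_ge0 (complex.Im l).
  have : complex.Im l * ((nrm h ^+ 2 + 1) / (2 * complex.Im l)) = (nrm h ^+ 2 + 1) / 2 by field.
  move: (_ / (2 * _)) (complex.Re l ^+ 2) => t u; rewrite sqrrD; lra.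
have lRe : `|complex.Re l| <= nrm h.
  have := sq_bound 0; rewrite lIm !expr0n /= addr0 expr0n !addr0 => H.
  by rewrite -(ger0_norm (nrm_ge0 h)) -(ler_pXn2r (_ : 0 < 2)%N) ?nnegrE // !real_normK ?num_real.
have lE : l = (complex.Re l)%:C%C by move: lIm; case: (l) => a b /= ->.
by rewrite -phik phiE lE horner_map normcM !normcR -normrM; exact: fM.
Qed.

(** Splitting off the constant term gives a crude bound [3 M^N] for [f ^+ N]: [2 M^N] for the part
    divisible by ['X], [M^N] for the constant. Since [g u ^+ 2 <= g (u u)] on real polynomials, the
    powers [N = 2^i] remove the factor 3. *)
Lemma nrm_act_le f (M : R) y :
  (forall t, `|t| <= nrm h -> `|f.[t]| <= M) -> nrm (act (toC f) y) <= M * nrm y.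
Proof.
move=> fM.
have M0 : 0 <= M by apply: le_trans (normr_ge0 _) (fM 0 _); rewrite normr0 nrm_ge0.
have [y0|y0] := eqVneq (nrm y) 0.
  by rewrite (nrm_eq0 y0); have := act_mulr (toC f) 0 0; rewrite !csmul0r => ->; rewrite nrm0 mulr0.
have ypos : 0 < nrm y by rewrite lt0r y0 nrm_ge0.
rewrite -ler_pdivrMr //.
pose g F := nrm (act F y) / nrm y.
have g0 F : 0 <= g F by rewrite divr_ge0 ?nrm_ge0.
have toCM u v : toC (u * v) = toC u * toC v by rewrite /toC rmorphM.
have gsqr u : g (toC u) ^+ 2 <= g (toC (u * u)).
  rewrite /g expr_div_n ler_pdivrMr ?exprn_gt0 // expr2 mulrA mulfVK //.
  by have := nrm_act_sqr (toC u) y; rewrite conj_toC toCM [nrm y * _]mulrC.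
apply: (@le_of_exp_le _ _ 3) => [||i] //; first exact: g0.
apply: (@le_trans _ _ (g (toC (f ^+ (2 ^ i))))).
  elim: i => [|i IH]; first by rewrite !expr1.
  rewrite expnSr !exprM (le_trans _ (gsqr _)) // lerXn2r // nnegrE ?exprn_ge0 //; exact: g0.
set F := f ^+ _; set N := (2 ^ i)%N in F *.
have FM t : `|t| <= nrm h -> `|F.[t]| <= M ^+ N.
  by move=> th; rewrite horner_exp normrX lerXn2r // ?nnegrE //; exact: fM.
have [G FE] : exists G : {poly R}, F = G * 'X + F.[0]%:P.
  have /factor_theorem[G GE] : root (F - F.[0]%:P) 0.
    by rewrite rootE !hornerE subrr.
  by exists G; rewrite -[X in G * X]subr0 -GE subrK.
have GM : nrm (act (toC G) h) <= 2 * M ^+ N.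
  apply: nrm_act_self_le => t th.
  have -> : t * G.[t] = F.[t] - F.[0] by rewrite {1}FE !hornerE addrK mulrC.
  have := FM t th; have := FM 0; rewrite normr0 nrm_ge0 => /(_ isT).
  by have := ler_normB F.[t] F.[0]; lra.
rewrite /g ler_pdivrMr // FE /toC rmorphD rmorphM /= map_polyX map_polyC /=.
rewrite act_mulX_polyC act_mulr (le_trans (nrmD _ _)) //.
have -> : 3 * M ^+ N * nrm y = 2 * M ^+ N * nrm y + M ^+ N * nrm y by ring.
rewrite lerD //.
  by rewrite (le_trans (nrmM _ _)) // ler_wpM2r ?nrm_ge0.
by rewrite nrmZ normcR ler_wpM2r ?nrm_ge0 // FM // normr0 nrm_ge0.
Qed.

End PolynomialCalculus.

(** * A function vanishing more slowly than all powers *)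

Section UniformApproximation.
Variable R : realType.
Implicit Types (F G : R -> R) (f g : {poly R}) (t e B : R).

Lemma bernoulli_ge (x : R) n : 0 <= x -> x <= 1 -> 1 - n%:R * x <= (1 - x) ^+ n.
Proof.
move=> x0 x1; elim: n => [|n IH]; first by rewrite mul0r subr0.
rewrite exprS; apply: (@le_trans _ _ ((1 - x) * (1 - n%:R * x))).
  have : 0 <= n%:R * x * x by rewrite !mulr_ge0.
  by rewrite -[n.+1]addn1 natrD; lra.
by rewrite ler_wpM2l // subr_ge0.
Qed.

Lemma exp_one_sub_le (x : R) n : 0 <= x -> x <= 1 -> (1 + n%:R * x) * (1 - x) ^+ n <= 1.
Proof.
move=> x0 x1; have y0 : 0 <= 1 - x by lra.
elim: n => [|n IH]; first by rewrite mul0r addr0 mul1r.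
apply: le_trans IH; rewrite exprS mulrA ler_wpM2r ?exprn_ge0 //.
have : 0 <= n%:R * x * x by rewrite !mulr_ge0.
have : 0 <= x * x by rewrite mulr_ge0.
by rewrite -[n.+1]addn1 natrD; lra.
Qed.

(** Stands in for continuity on [[-1,1]]; the functions below are built by operations that preserve
    it. *)
Definition papprox F := forall e, 0 < e ->
  exists f, forall t, `|t| <= 1 -> `|F t - f.[t]| <= e.

Lemma horner_bounded f : exists2 B, 0 <= B & forall t, `|t| <= 1 -> `|f.[t]| <= B.
Proof.
elim/poly_ind: f => [|f c [B B0 IH]].
  by exists 0 => // t _; rewrite horner0 normr0.
exists (B + `|c|) => [|t t1]; first by rewrite addr_ge0.
rewrite hornerMXaddC (le_trans (ler_normD _ _)) // lerD2r normrM.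
by rewrite -[B]mulr1 ler_pM // IH.
Qed.

Lemma papprox_bounded F : papprox F ->
  exists2 B, 0 <= B & forall t, `|t| <= 1 -> `|F t| <= B.
Proof.
move=> /(_ 1 ltr01)[f Hf]; have [B B0 HB] := horner_bounded f.
exists (B + 1) => [|t t1]; first by rewrite addr_ge0.
by have := Hf t t1; have := HB t t1; have := ler_normD (F t - f.[t]) f.[t];
  rewrite subrK; lra.
Qed.

Lemma papprox_poly f : papprox (horner f).
Proof. by move=> e e0; exists f => t _; rewrite subrr normr0 ltW. Qed.

Lemma papproxD F G : papprox F -> papprox G -> papprox (fun t => F t + G t).
Proof.
move=> aF aG e e0; have e20 : 0 < e / 2 by lra.
have [f Hf] := aF _ e20; have [g Hg] := aG _ e20.
exists (f + g) => t t1; rewrite hornerD opprD addrACA (le_trans (ler_normD _ _)) //.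
by have := Hf t t1; have := Hg t t1; lra.
Qed.

Lemma mul_error (x y x' y' B d : R) : `|x| <= B -> `|y| <= B -> d <= 1 ->
  `|x - x'| <= d -> `|y - y'| <= d -> `|x * y - x' * y'| <= (2 * B + 1) * d.
Proof.
move=> xB yB d1 xd yd.
have -> : x * y - x' * y' = x * (y - y') + (x - x') * y - (x - x') * (y - y') by ring.
have H : `|x * (y - y')| + `|(x - x') * y| + `|(x - x') * (y - y')| <= (2 * B + 1) * d.
  have -> : (2 * B + 1) * d = B * d + d * B + 1 * d by ring.
  by rewrite !normrM !lerD // ler_pM // (le_trans xd).
by rewrite (le_trans (ler_normB _ _)) // (le_trans _ H) // lerD2r ler_normD.
Qed.

Lemma mul_delta B e : 0 <= B -> 0 < e ->
  exists d, [/\ 0 < d, d <= 1, d <= e & (2 * B + 1) * d <= e].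
Proof.
move=> B0 e0; have C0 : 0 < 2 * B + 1 by lra.
exists (Num.min 1 (e / (2 * B + 1))).
have h : Num.min 1 (e / (2 * B + 1)) <= e / (2 * B + 1) by rewrite ge_min lexx orbT.
split; rewrite ?ge_min ?lexx // ?lt_min ?ltr01 ?divr_gt0 //.
  by rewrite (ler_pdivrMr _ _ C0); apply/orP; right; nra.
by rewrite mulrC -ler_pdivlMr.
Qed.

Lemma papproxM F G : papprox F -> papprox G -> papprox (fun t => F t * G t).
Proof.
move=> aF aG e e0.
have [BF BF0 HBF] := papprox_bounded aF; have [BG BG0 HBG] := papprox_bounded aG.
have B0 : 0 <= BF + BG by lra.
have [d [d0 d1 _ de]] := mul_delta B0 e0.
have [f Hf] := aF _ d0; have [g Hg] := aG _ d0.
exists (f * g) => t t1; rewrite hornerM; apply: le_trans de.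
apply: mul_error d1 (Hf t t1) (Hg t t1).
  by rewrite (le_trans (HBF t t1)) // lerDl.
by rewrite (le_trans (HBG t t1)) // lerDr.
Qed.

Lemma papprox_horner f F : papprox F -> papprox (fun t => f.[F t]).
Proof.
move=> aF; elim/poly_ind: f => [|f c IH].
  move=> e e0; exists 0 => t _; by rewrite !horner0 subrr normr0 ltW.
have -> : (fun t => (f * 'X + c%:P).[F t]) = (fun t => f.[F t] * F t + (c%:P).[t]).
  by apply/funext => t; rewrite hornerMXaddC hornerC.
by apply: papproxD (papprox_poly _); exact: papproxM.
Qed.

Lemma papprox_lim F : (forall e, 0 < e ->
  exists2 G, papprox G & forall t, `|t| <= 1 -> `|F t - G t| <= e) -> papprox F.
Proof.
move=> H e e0; have e20 : 0 < e / 2 by lra.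
have [G aG FG] := H _ e20; have [g Hg] := aG _ e20; exists g => t t1.
by rewrite -(subrKA (G t)) (le_trans (ler_normD _ _)) //;
  have := FG t t1; have := Hg t t1; lra.
Qed.

End UniformApproximation.

Section SlowFunction.
Variable R : realType.
Implicit Types (t e d : R).

(* [slow] vanishes at 0 only, but more slowly than any power of [|t|]. *)
Let m j := (4 ^ (j * j))%N.
(** [c j] climbs from 0 towards 1 around [|t| = 2^(-j*j)]. With weights [2^(-j-1)], the sum is
    roughly [2^(-j)] there, that is [2^(-sqrt(log2(1/|t|)))], which beats every power of [|t|]. *)
Let c j t := 1 - (1 - t ^+ 2) ^+ m j.
Let half j := (2^-1 : R) ^+ j.
Let S n t := \sum_(j < n) half j.+1 * c j t.

(** On [[-1,1]] the partial sums increase, so this supremum is the sum of the series. *)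
Definition slow t := sup (range (fun n => S n t)).

Let half_gt0 j : 0 < half j. Proof. by rewrite exprn_gt0 // invr_gt0. Qed.

Let halfS j : half j = 2 * half j.+1.
Proof. by rewrite /half exprS; lra. Qed.

Let sqr01 t : `|t| <= 1 -> 0 <= t ^+ 2 <= 1.
Proof.
by move=> t1; rewrite sqr_ge0 -real_normK ?num_real // exprn_ile1.
Qed.

Let c01 j t : `|t| <= 1 -> 0 <= c j t <= 1.
Proof.
move=> /sqr01/andP[t0 t1]; have ? : 0 <= 1 - t ^+ 2 by rewrite subr_ge0.
by rewrite /c lerBlDr lerDl exprn_ge0 // andbT subr_ge0 exprn_ile1 // lerBlDr lerDl.
Qed.

Let SS n t : S n.+1 t = S n t + half n.+1 * c n t.
Proof. by rewrite /S big_ord_recr. Qed.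

Let S_mono n k t : `|t| <= 1 -> S n t <= S (n + k) t <= S n t + half n - half (n + k).
Proof.
move=> t1; elim: k => [|k /andP[IH1 IH2]]; first by rewrite addn0 lexx addrK lexx.
have /andP[c0 c1] := c01 (n + k) t1.
have H : 0 <= half (n + k).+1 * c (n + k) t <= half (n + k).+1.
  by apply/andP; split; [exact: mulr_ge0 (ltW (half_gt0 _)) c0|rewrite ler_piMr // ltW].
by move: H; rewrite addnS SS; have := halfS (n + k); lra.
Qed.

Let S_ub n t : `|t| <= 1 -> ubound (range (fun n => S n t)) (S n t + half n).
Proof.
move=> t1 _ [k _ <-]; have [kn|/ltnW nk] := leqP k n.
  have := S_mono k (n - k) t1; rewrite subnKC // => /andP[H _].
  by rewrite (le_trans H) // lerDl ltW.
have := S_mono n (k - n) t1; rewrite subnKC // => /andP[_ H].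
by rewrite (le_trans H) // lerBlDr lerDl ltW.
Qed.

Let slow_bounds n t : `|t| <= 1 -> S n t <= slow t <= S n t + half n.
Proof.
move=> t1; have ne : range (fun n => S n t) !=set0 by exists (S 0 t), 0%N.
apply/andP; split; last exact: ge_sup (S_ub n t1).
by apply: sup_upper_bound; [split=> //; exists (S 0 t + half 0); exact: S_ub|exists n].
Qed.

Lemma slow_ge0 t : `|t| <= 1 -> 0 <= slow t.
Proof. by move=> /(slow_bounds 0)/andP[+ _]; rewrite /S big_ord0. Qed.

Lemma slow_le1 t : `|t| <= 1 -> slow t <= 1.
Proof. by move=> /(slow_bounds 0)/andP[_]; rewrite /S big_ord0 add0r. Qed.

Lemma slow0 : slow 0 = 0.
Proof.
have S0 n : S n 0 = 0.
  rewrite /S big1 // => j _; by rewrite /c expr0n subr0 expr1n subrr mulr0.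
rewrite /slow; have -> : range (fun n => S n 0) = [set 0]; last exact: sup1.
by apply/seteqP; split=> [_ [n _ <-]|_ ->] /=; [exact: S0|exists 0%N].
Qed.

Lemma slow_gt0 t : `|t| <= 1 -> t != 0 -> 0 < slow t.
Proof.
move=> t1 tn0; have /andP[+ _] := slow_bounds 1 t1; apply: lt_le_trans.
(* Since [m 0 = 1], the first term alone is [t^2 / 2]. *)
rewrite /S big_ord1 mulr_gt0 // /c /m mul0n expn0 expr1 subKr.
by rewrite lt0r sqr_ge0 andbT expf_eq0.
Qed.

Lemma papprox_slow : papprox slow.
Proof.
apply: papprox_lim => e e0.
have [n Hn] := @exp_lt_eps R 2^-1 e ltac:(lra) ltac:(lra) e0.
pose f := \sum_(j < n) (half j.+1)%:P * (1 - (1 - 'X ^+ 2) ^+ m j) : {poly R}.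
exists (horner f) => [|t t1]; first exact: papprox_poly.
have -> : f.[t] = S n t.
  by rewrite /f horner_sum; apply: eq_bigr => j _; rewrite !hornerE.
have /andP[h1 h2] := slow_bounds n t1.
rewrite ger0_norm ?subr_ge0 // lerBlDl (le_trans h2) // lerD2l ltW //.
exact: Hn.
Qed.

(** The hypothesis forces [c j t < 1/2], so [(1 - t^2)^(m j) > 1/2]; then [exp_one_sub_le] gives
    [m j * t^2 <= 1]. *)
Let slow_small j t : `|t| <= 1 -> slow t < half j.+2 -> `|t| <= half (j * j).
Proof.
move=> t1 H; have /andP[q0 q1] := sqr01 t1.
have /andP[Sj _] := slow_bounds j.+1 t1.
have Sj0 : 0 <= S j t.
  by have := S_mono 0 j t1; rewrite add0n {1}/S big_ord0 => /andP[].
have : half j.+1 * c j t < half j.+1 / 2.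
  by move: Sj H; rewrite SS (halfS j.+1); lra.
rewrite ltr_pM2l // /c => cj.
have := exp_one_sub_le (m j) q0 q1.
have mq0 : 0 <= (m j)%:R * t ^+ 2 by rewrite mulr_ge0.
have y0 : 2^-1 < (1 - t ^+ 2) ^+ m j by lra.
move=> hle; have {hle} mq : (m j)%:R * t ^+ 2 <= 1.
  by move: (_ ^+ m j) (_ * _ ^+ 2) hle mq0 y0 => u v; nra.
rewrite -(ler_pXn2r (_ : 0 < 2)%N) ?nnegrE ?(ltW (half_gt0 _)) //.
rewrite real_normK ?num_real //.
have -> : half (j * j) ^+ 2 = (m j)%:R^-1.
  by rewrite /half /m natrX -exprVn exprAC; congr (_ ^+ _); field.
by rewrite -[_^-1]mulr1 ler_pdivlMl // ltr0n expn_gt0.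
Qed.

Lemma slow_decay n e : 0 < e -> exists2 d, 0 < d &
  forall t, `|t| <= 1 -> slow t < d -> `|t| <= e * slow t ^+ n.
Proof.
move=> e0; have [K HK] := @exp_lt_eps R 2^-1 e ltac:(lra) ltac:(lra) e0.
(* For [j >= J] one has [K + (j + 3) n <= j * j], so [2^(-j*j)] is below [e] times the [n]-th power
   of [2^(-j-3)], the lower bound for [slow t]. *)
pose J := (4 * n + K).+1; exists (half (J + 2)) => // t t1 bJ.
have [->|tn0] := eqVneq t 0.
  by rewrite normr0 mulr_ge0 ?exprn_ge0 ?slow_ge0 ?normr0 // ltW.
have b0 := slow_gt0 t1 tn0.
have ex : exists j, half (j + 3) <= slow t.
  have [j Hj] := @exp_lt_eps R 2^-1 _ ltac:(lra) ltac:(lra) b0.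
  by exists j; rewrite ltW // Hj // leq_addr.
case: (ex_minnP ex) => j Hj jmin.
have half_anti a b : (a <= b)%N -> half b <= half a.
  by move=> ab; rewrite /half ler_wiXn2l //; lra.
have jJ : (J <= j)%N.
  rewrite leqNgt; apply/negP => jJ; have := le_lt_trans Hj bJ.
  by rewrite ltNge half_anti // addnS ltn_add2r.
have {jmin} jb : slow t < half j.+2.
  rewrite ltNge; apply/negP; case: j jJ {Hj} jmin => // j _ jmin jb.
  by have := jmin j; rewrite addn3 => /(_ jb); rewrite ltnn.
apply: le_trans (slow_small t1 jb) _.
apply: (@le_trans _ _ (e * half (j + 3) ^+ n)); last first.
  by rewrite ler_wpM2l ?(ltW e0) // lerXn2r // nnegrE ltW.
have {}HK := ltW (HK K (leqnn K)).
apply: (@le_trans _ _ (half K * half (j + 3) ^+ n)); last first.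
  by rewrite ler_wpM2r // exprn_ge0 // ltW.
rewrite /half -exprM -exprD; apply: half_anti.
have : (4 * n + K < j)%N by [].
by nia.
Qed.

End SlowFunction.

(** * Slow roots of self-adjoint elements *)


Section SlowQuotient.
Variable R : realType.

(** The inverse of [b = slow t] is replaced by the truncated geometric series [g], for which
    [b g(b) = 1 - (1 - b)^M]. Where [b] is small, [slow_decay] makes the whole quotient at most [e];
    elsewhere [(1 - b)^M] is uniformly small. *)
Lemma papprox_div_slow n : papprox (fun t : R => t / slow t ^+ n).
Proof.
apply: papprox_lim => e e0.
have [d d0 Hd] := slow_decay n e0.
pose d1 := Num.min d 1.
have d10 : 0 < d1 by rewrite lt_min d0 ltr01.
have dn0 : 0 < d1 ^+ n by rewrite exprn_gt0.
have r0 : 0 <= 1 - d1 by rewrite subr_ge0 ge_min lexx orbT.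
have r1 : 1 - d1 < 1 by lra.
(* Bernoulli's inequality costs a factor [n]; [n.+1] keeps the denominator positive when [n = 0]. *)
have e1 : 0 < e * d1 ^+ n / n.+1%:R by rewrite divr_gt0 // mulr_gt0.
have [M HM] := exp_lt_eps r0 r1 e1.
pose g := \sum_(i < M) (1 - 'X) ^+ i : {poly R}.
have gE b : b * g.[b] = 1 - (1 - b) ^+ M.
  rewrite -[RHS]opprB subrX1 -mulNr opprB subKr; congr (_ * _).
  by rewrite /g horner_sum; apply: eq_bigr => i _; rewrite !hornerE.
exists (fun t => t * (g ^+ n).[slow t]).
  have -> : (fun t => t * (g ^+ n).[slow t]) = (fun t => ('X : {poly R}).[t] * (g ^+ n).[slow t]).
    by apply/funext => t; rewrite hornerX.
  by apply: papproxM; [exact: papprox_poly|apply/papprox_horner/papprox_slow].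
move=> t t1; have [->|tn0] := eqVneq t 0; first by rewrite !mul0r subrr normr0 ltW.
have b0 := slow_gt0 t1 tn0; have b1 := slow_le1 t1.
set b := slow t in b0 b1 *; have bn0 : 0 < b ^+ n by rewrite exprn_gt0.
have -> : t / b ^+ n - t * (g ^+ n).[b] = (t / b ^+ n) * (1 - (1 - (1 - b) ^+ M) ^+ n).
  by rewrite -gE exprMn mulrBr mulr1 mulrA mulfVK ?gt_eqF // horner_exp.
have x01 : 0 <= (1 - b) ^+ M <= 1.
  by rewrite exprn_ge0 ?exprn_ile1 ?subr_ge0 // lerBlDr lerDl ltW.
move/andP: x01 => [x0 x1]; set x := (1 - b) ^+ M in x0 x1 *.
have y01 : 0 <= 1 - (1 - x) ^+ n <= 1.
  by rewrite subr_ge0 exprn_ile1 ?subr_ge0 ?lerBlDr ?lerDl // exprn_ge0 // subr_ge0.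
move/andP: y01 => [y0 y1].
rewrite normrM normf_div (ger0_norm y0) (ger0_norm (ltW bn0)) mulrAC ler_pdivrMr //.
have [bd|bd] := ltP b d.
  by rewrite -[leRHS]mulr1 ler_pM // Hd.
have d1b : d1 <= b by rewrite ge_min bd.
apply: (@le_trans _ _ (1 * (n%:R * x))).
  apply: ler_pM => //; have := bernoulli_ge n x0 x1; lra.
rewrite mul1r; apply: (@le_trans _ _ (e * d1 ^+ n)); last first.
  by rewrite ler_wpM2l ?(ltW e0) // lerXn2r // nnegrE ltW.
apply: (@le_trans _ _ (n.+1%:R * (1 - d1) ^+ M)).
  apply: ler_pM => //; first by rewrite ler_nat.
  by rewrite lerXn2r // ?nnegrE ?subr_ge0 // lerB.
by rewrite mulrC -ler_pdivlMr // ltW // HM.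
Qed.

End SlowQuotient.

Section Completeness.
Variables (R : realType) (A : cstar_algebra R).

Lemma nrm_complete (u : nat -> A) :
  (forall e : R, 0 < e -> exists N, forall n, (N <= n)%N -> nrm (u n - u N) <= e) ->
  exists a, forall e : R, 0 < e -> exists N, forall n, (N <= n)%N -> nrm (u n - a) <= e.
Proof.
move=> H.
(* In the order of [R[i]] a positive element is real, so real radii suffice. *)
have posC (e : R[i]) : 0 < e -> exists2 r : R, 0 < r & e = r%:C%C.
  case: e => a b; rewrite ltcE /= => /andP[/eqP -> a0]; by exists a.
have /cauchy_cvg cu : cauchy (u @ \oo).
  apply: cauchy_exP => _ /posC[r r0 ->]; have r20 : 0 < r / 2 by lra.
  have [N HN] := H _ r20; exists (u N); exists N => // n /= Nn.
  rewrite -ball_normE /= nrmE ltcR -nrmN opprB; apply: le_lt_trans (HN n Nn) _; lra.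
exists (lim (u @ \oo)) => e e0.
have eC : 0 < e%:C%C :> R[i] by rewrite ltcR.
have /cvgrPdist_lt /(_ _ eC) [N _ HN] := cu.
by exists N => n Nn; have := HN n Nn; rewrite /= nrmE ltcR -nrmN opprB => /ltW.
Qed.

End Completeness.

Section SlowRoot.
Variables (R : realType) (A : cstar_algebra R) (h : A).

Local Notation "x ** y" := (@cs_mul R A x y) (at level 40, left associativity).
Local Notation star := (@cs_star R A).
Local Notation toC := (map_poly (real_complex R)).

Hypothesis sah : star h = h.
Hypothesis h1 : nrm h <= 1.

(* [represents F a]: continuous functional calculus, [a = F(h)], for [F 0 = 0]. *)
Definition represents (F : R -> R) (a : A) := forall e : R, 0 < e -> exists g : {poly R},
  (forall t, `|t| <= 1 -> `|F t - t * g.[t]| <= e) /\ nrm (a - act h (toC g) h) <= e.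

Let nrm_act_sub (f g : {poly R}) e : (forall t, `|t| <= 1 -> `|t * f.[t] - t * g.[t]| <= e) ->
  nrm (act h (toC f) h - act h (toC g) h) <= e.
Proof.
move=> H; rewrite -actB -rmorphB; apply: nrm_act_self_le => // t th.
by rewrite hornerD hornerN mulrBr H // (le_trans th).
Qed.

Lemma represents_unique F a b : represents F a -> represents F b -> a = b.
Proof.
move=> Fa Fb; apply/eqP; rewrite -subr_eq0; apply/eqP/nrm_eq0/eqP.
rewrite eq_le nrm_ge0 andbT; apply/ler_addgt0Pr => e e0; rewrite add0r.
have e40 : 0 < e / 4 by lra.
have [f [Ff af]] := Fa _ e40; have [g [Fg bg]] := Fb _ e40.
have fg : nrm (act h (toC f) h - act h (toC g) h) <= e / 2.
  apply: nrm_act_sub => t t1; rewrite -(subrKA (F t)) (le_trans (ler_normD _ _)) // distrC.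
  by have := Ff t t1; have := Fg t t1; lra.
have := nrmD (a - act h (toC f) h) (act h (toC f) h - b); rewrite subrKA.
have := nrmD (act h (toC f) h - act h (toC g) h) (act h (toC g) h - b); rewrite subrKA.
have : nrm (act h (toC g) h - b) <= e / 4 by rewrite -nrmN opprB.
lra.
Qed.

Lemma represents_id : represents id h.
Proof.
move=> e e0; exists 1; split=> [t _|].
  by rewrite hornerE mulr1 subrr normr0 ltW.
by rewrite rmorph1 act1 subrr nrm0 ltW.
Qed.

Lemma eq_represents F G a : (forall t, `|t| <= 1 -> F t = G t) ->
  represents F a -> represents G a.
Proof. by move=> FG Fa e /Fa[g [H1 H2]]; exists g; split=> // t t1; rewrite -FG // H1. Qed.

Lemma represents_exists F : papprox F -> F 0 = 0 -> exists a, represents F a.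
Proof.
move=> aF F0.
have H (n : nat) : exists g : {poly R}, forall t, `|t| <= 1 -> `|F t - t * g.[t]| <= n.+1%:R^-1.
  have : 0 < n.+1%:R^-1 :> R by rewrite invr_gt0.
  move: (n.+1%:R^-1) => e ne; have e0 : 0 < e / 2 by lra.
  have [f Hf] := aF _ e0.
  (* Dropping the constant term costs only another [e / 2], because [F 0 = 0]. *)
  have /factor_theorem[g gE] : root (f - f.[0]%:P) 0 by rewrite rootE !hornerE subrr.
  exists g => t t1; have -> : t * g.[t] = f.[t] - f.[0].
    have -> : f.[t] - f.[0] = (f - f.[0]%:P).[t] by rewrite !hornerE.
    by rewrite gE !hornerE subr0 mulrC.
  rewrite opprB addrA -addrAC (le_trans (ler_normD _ _)) //.
  have := Hf 0; rewrite normr0 ler01 F0 sub0r normrN => /(_ isT).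
  by have := Hf t t1; lra.
have [g Hg] := choice H.
pose u n := act h (toC (g n)) h.
have eps e : 0 < e -> exists N, forall n, (N <= n)%N -> n.+1%:R^-1 <= e :> R.
  move=> e0; exists (Num.truncn e^-1) => n Nn.
  rewrite -[leRHS]invrK lef_pV2 ?posrE ?invr_gt0 // ltW //.
  by rewrite (lt_le_trans (truncnS_gt _)) // ler_nat.
have [|a Ha] := @nrm_complete R A u.
  move=> e e0; have e20 : 0 < e / 2 by lra.
  have [N HN] := eps _ e20; exists N => n Nn; apply: nrm_act_sub => t t1.
  rewrite -(subrKA (F t)) (le_trans (ler_normD _ _)) // distrC.
  have := Hg n t t1; have := Hg N t t1; have := HN n Nn; have := HN N (leqnn N).
  by move: (n.+1%:R^-1) (N.+1%:R^-1) => ? ?; lra.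
exists a => e e0; have [N HN] := eps _ e0; have [N' HN'] := Ha _ e0.
exists (g (maxn N N')); split=> [t t1|].
  by rewrite (le_trans (Hg _ t t1)) // HN // leq_maxl.
by rewrite -nrmN opprB HN' // leq_maxr.
Qed.

Lemma representsM F G a b : papprox F -> papprox G ->
  represents F a -> represents G b -> represents (fun t => F t * G t) (a ** b).
Proof.
move=> aF aG Fa Gb e e0.
have [BF BF0 HBF] := papprox_bounded aF; have [BG BG0 HBG] := papprox_bounded aG.
pose B := BF + BG + nrm a + nrm b.
have na := nrm_ge0 a; have nb := nrm_ge0 b.
have B0 : 0 <= B by rewrite /B; lra.
have [d [d0 d1 _ de]] := mul_delta B0 e0.
have [f [Ff af]] := Fa _ d0; have [g [Gg bg]] := Gb _ d0.
exists (f * 'X * g); split=> [t t1|].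
  have -> : t * (f * 'X * g).[t] = (t * f.[t]) * (t * g.[t]) by rewrite !hornerE; ring.
  apply: le_trans de; apply: mul_error d1 (Ff t t1) (Gg t t1).
    by rewrite (le_trans (HBF t t1)) // /B; lra.
  by rewrite (le_trans (HBG t t1)) // /B; lra.
rewrite !rmorphM /= map_polyX actM_mul; apply: le_trans de.
set a' := act _ _ _ in af *; set b' := act _ _ _ in bg *.
have -> : a ** b - a' ** b' = a ** (b - b') + (a - a') ** b - (a - a') ** (b - b').
  by rewrite !csmulBr !csmulBl opprB addrA addrAC addrK subrKA.
have H1 : nrm (a ** (b - b')) <= B * d.
  by rewrite (le_trans (nrmM _ _)) // ler_pM ?nrm_ge0 // /B; lra.
have H2 : nrm ((a - a') ** b) <= d * B.
  by rewrite (le_trans (nrmM _ _)) // ler_pM ?nrm_ge0 // /B; lra.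
have H3 : nrm ((a - a') ** (b - b')) <= 1 * d.
  by rewrite (le_trans (nrmM _ _)) // ler_pM ?nrm_ge0 // (le_trans af).
have := nrmB (a ** (b - b') + (a - a') ** b) ((a - a') ** (b - b')).
by have := nrmD (a ** (b - b')) ((a - a') ** b); lra.
Qed.

(** [b] represents [slow] and [c] represents [t / slow t ^+ n.+1], the exponent matching
    [cspow b n]; the product represents the identity, as [h] does. *)
Lemma contraction_slow_root : exists b, forall n, exists c, h = c ** cspow b n.
Proof.
have [b Hb] := represents_exists (@papprox_slow R) (@slow0 R).
exists b => n.
have [|c Hc] := represents_exists (@papprox_div_slow R n.+1); first by rewrite mul0r.
exists c; apply: (represents_unique represents_id).
have powE k : papprox (fun t : R => slow t ^+ k.+1).
  have -> : (fun t : R => slow t ^+ k.+1) = (fun t => ('X ^+ k.+1 : {poly R}).[slow t]).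
    by apply/funext => t; rewrite hornerXn.
  exact/papprox_horner/papprox_slow.
have Hpow k : represents (fun t => slow t ^+ k.+1) (cspow b k).
  elim: k => [|k IH]; first exact: Hb.
  by under eq_fun do rewrite exprS; apply: representsM => //; exact: papprox_slow.
apply: eq_represents (representsM (@papprox_div_slow R n.+1) (powE n) Hc (Hpow n)).
move=> t t1; have [->|tn0] := eqVneq t 0; first by rewrite !mul0r.
by rewrite mulfVK // expf_neq0 // gt_eqF // slow_gt0.
Qed.

End SlowRoot.

Section Factorization.
Variables (R : realType) (A : cstar_algebra R).

Local Notation "x ** y" := (@cs_mul R A x y) (at level 40, left associativity).
Local Notation star := (@cs_star R A).

Lemma slow_root (h : A) : star h = h -> exists b, forall n, exists c, h = c ** cspow b n.
Proof.
move=> sah; have [h0|hn0] := eqVneq (nrm h) 0.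
  by exists 0 => n; exists 0; rewrite csmul0l; exact: nrm_eq0.
have h0 : 0 < nrm h by rewrite lt0r hn0 nrm_ge0.
pose r := (nrm h)^-1.
have [||b Hb] := @contraction_slow_root R A (r%:C%C *: h).
- by rewrite csstarZ conjc_real sah.
- by rewrite nrmZ normcR ger0_norm ?invr_ge0 ?nrm_ge0 // mulVf.
exists b => n; have [c Hc] := Hb n; exists ((nrm h)%:C%C *: c).
by rewrite csmulZl -Hc scalerA -rmorphM mulfV // scale1r.
Qed.

Lemma selfadjoint_decomposition (x : A) : exists h k,
  [/\ star h = h, star k = k & x = h + 'i%C *: k].
Proof.
have starB y z : star (y - z) = star y - star z.
  by rewrite csstarD -scaleN1r csstarZ rmorphN1 scaleN1r.
pose a : R[i] := (2^-1)%:C%C; pose b : R[i] := Complex 0 (- 2^-1).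
have ib : 'i%C * b = a by apply/eqP; rewrite eq_complex /=; apply/andP; split; apply/eqP; ring.
have aa : a + a = 1 by rewrite -rmorphD /= -mulr2n -[_ *+ 2]mulr_natr mulVf.
exists (a *: (x + star x)), (b *: (x - star x)); split.
- by rewrite csstarZ conjc_real csstarD csstarK addrC.
- rewrite csstarZ starB csstarK -[star x - x]opprB scalerN -scaleNr; congr (_ *: _).
  by apply/eqP; rewrite /b eq_complex /= oppr0 opprK !eqxx.
- rewrite scalerA ib -scalerDr addrACA subrr addr0.
  by rewrite scalerDr -scalerDl aa scale1r.
Qed.

(** [slow_root] fixes [b] before [n], so the exponent that [I] provides for this [b] may be used in
    the factorization. *)
Lemma ideal_radical_full (I : set A) : ideal I ->
  (forall b, exists n, I (cspow b n)) -> I = setT.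
Proof.
move=> [IG IM] H; apply/seteqP; split=> // x _.
have [h [k [sh sk ->]]] := selfadjoint_decomposition x.
have [b Hb] := slow_root sh; have [b' Hb'] := slow_root sk.
have [n Ib] := H b; have [n' Ib'] := H b'.
have [c ->] := Hb n; have [c' ->] := Hb' n'.
by apply: (subgroupD IG); rewrite -?csmulZl; [exact: (IM _ _ Ib).1|exact: (IM _ _ Ib').1].
Qed.

Lemma subgroup_triple_full (G : set A) : is_addsubgroup G ->
  (forall a y b, G (a ** y ** b)) -> G = setT.
Proof.
move=> GG H; apply/seteqP; split=> // x _.
have [h [k [sh sk ->]]] := selfadjoint_decomposition x.
have [b Hb] := slow_root sh; have [b' Hb'] := slow_root sk.
(* Exponent index 1 gives [h = c b b], a triple product; the scalar of [k] is absorbed in [c']. *)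
have [c ->] := Hb 1%N; have [c' ->] := Hb' 1%N.
by apply: (subgroupD GG); rewrite -?csmulZl /cspow /= csmulA.
Qed.

End Factorization.

(** * Distance to an ideal *)


Section Distance.
Variables (R : realType) (A : cstar_algebra R).

Local Notation "x ** y" := (@cs_mul R A x y) (at level 40, left associativity).
Local Notation star := (@cs_star R A).
Local Notation toC := (map_poly (real_complex R)).

(** With [s = t / r] and [v = (1 - s^2)^m], [exp_one_sub_le] at exponent [2m] gives
    [2m s^2 v^2 <= 1], so [m > r^2 / e^2] suffices. *)
Lemma exp_one_sub_sqr_small (r e : R) : 0 < r -> 0 < e -> exists m, forall t,
  `|t| <= r -> `|t * (1 - (t / r) ^+ 2) ^+ m| <= e.
Proof.
move=> r0 e0; have re0 : 0 <= r ^+ 2 / e ^+ 2 by rewrite divr_ge0 ?sqr_ge0.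
pose m := (Num.truncn (r ^+ 2 / e ^+ 2)).+1; exists m => t tr.
set s := t / r; have s1 : s ^+ 2 <= 1.
  by rewrite -real_normK ?num_real // exprn_ile1 // normf_div (gtr0_norm r0)
    ler_pdivrMr // mul1r.
have s0 : 0 <= s ^+ 2 by exact: sqr_ge0.
have := exp_one_sub_le (2 * m) s0 s1; set v := (1 - s ^+ 2) ^+ m.
have -> : (1 - s ^+ 2) ^+ (2 * m) = v ^+ 2 by rewrite mulnC exprM.
have -> : t = r * s by rewrite /s mulrC divfK // gt_eqF.
have m0 : r ^+ 2 / e ^+ 2 < m%:R by exact: truncnS_gt.
have M2 : m%:R <= (2 * m)%:R :> R by rewrite ler_nat leq_pmull.
move=> H.
rewrite -(ler_pXn2r (_ : 0 < 2)%N) ?nnegrE ?(ltW e0) //.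
rewrite real_normK ?num_real // exprMn exprMn.
have e20 : 0 < e ^+ 2 by rewrite exprn_gt0.
have {}m0 : r ^+ 2 < m%:R * e ^+ 2 by rewrite -ltr_pdivrMr.
have sv0 : 0 <= s ^+ 2 * v ^+ 2 by rewrite mulr_ge0 // sqr_ge0.
rewrite -mulrA; apply: (@le_trans _ _ (m%:R * e ^+ 2 * (s ^+ 2 * v ^+ 2))).
  by rewrite ler_wpM2r // ltW.
rewrite mulrAC -[leRHS]mul1r ler_wpM2r ?(ltW e20) //.
apply: le_trans H; rewrite mulrDl mul1r mulrA -[leLHS]add0r lerD ?sqr_ge0 //.
by rewrite ler_wpM2r ?sqr_ge0 // ler_wpM2r.
Qed.

Variable J : set A.
Hypothesis iJ : ideal J.
Hypothesis JZ : forall (c : R[i]) x, J x -> J (c *: x).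

Let JG : is_addsubgroup J := iJ.1.

(* [G] is left multiplication by [1 - e], where [e] in [J] is an approximate unit for [j]. *)
Lemma approximate_unit j (e : R) : J j -> 0 < e -> exists G : A -> A,
  [/\ forall x, nrm (G x) <= nrm x, forall x, J (x - G x), nrm (G j) <= e,
      forall x y, G (x + y) = G x + G y &
      forall x, nrm (G x) ^+ 2 <= nrm (G (x ** star x))].
Proof.
move=> Jj e0; have [j0|jn0] := eqVneq j 0.
  exists id; split=> // [x||x].
  - by rewrite subrr; exact: subgroup0.
  - by rewrite j0 nrm0 ltW.
  - by rewrite nrm_starr.
pose h := j ** star j.
have sh : star h = h by rewrite csstarM csstarK.
have Jh : J h by exact: (iJ.2 _ _ Jj).2.
have r0 : 0 < nrm h.
  rewrite nrm_starr exprn_gt0 // lt0r nrm_ge0 andbT.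
  by apply: contra jn0 => /eqP/nrm_eq0 ->.
(* The tolerance is [e ^+ 2], since [G j] is controlled through the square of its norm. *)
have [m Hm] := exp_one_sub_sqr_small r0 (exprn_gt0 2 e0).
pose g : {poly R} := (1 - ((nrm h)^-1 ^+ 2) *: 'X ^+ 2) ^+ m.
have gE t : g.[t] = (1 - (t / nrm h) ^+ 2) ^+ m.
  by rewrite /g horner_exp hornerD hornerN hornerC hornerZ hornerXn -exprMn mulrC.
pose G := act h (toC g).
have G1 x : nrm (G x) <= nrm x.
  rewrite -[leRHS]mul1r; apply: nrm_act_le => // t th.
  have s1 : (t / nrm h) ^+ 2 <= 1.
    by rewrite -real_normK ?num_real // exprn_ile1 // normf_div (gtr0_norm r0)
      ler_pdivrMr // mul1r.
  have s0 := sqr_ge0 (t / nrm h).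
  by rewrite gE ger0_norm ?exprn_ge0 ?exprn_ile1 ?subr_ge0 // lerBlDr lerDl.
(* One copy of [G] is discarded by contractivity; taking the adjoint brings the other next to
   [x (star x)]. *)
have Gsq x : nrm (G x) ^+ 2 <= nrm (G (x ** star x)).
  rewrite -nrm_starr /G -act_mulr (le_trans (G1 _)) // -[leLHS]nrm_star csstarM csstarK.
  by rewrite -act_mulr.
exists G; split=> //.
- move=> x; have [u uE] : exists u : {poly R}, 1 - g = u * 'X.
    have /factor_theorem[u uE] : root (1 - g) 0.
      by rewrite rootE hornerD hornerN gE hornerC mul0r expr0n subr0 expr1n subrr.
    by exists u; rewrite uE subr0.
  rewrite /G -{1}(act1 h x) -actB -(rmorph1 (map_poly (real_complex R))) -rmorphB uE.
  rewrite rmorphM /= map_polyX act_mulX; apply: act_ideal => //.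
  exact: (iJ.2 _ _ Jh).2.
- rewrite -(ler_pXn2r (_ : 0 < 2)%N) ?nnegrE ?nrm_ge0 ?(ltW e0) //.
  rewrite (le_trans (Gsq _)) //; apply: nrm_act_self_le => // t th.
  by rewrite gE; exact: Hm.
- by move=> x y; exact: act_addr.
Qed.

Definition dist x : R := inf [set nrm (x - j) | j in J].

Let J0 : J 0 := subgroup0 JG.

Lemma dist_le x j : J j -> dist x <= nrm (x - j).
Proof. by move=> Jj; apply: ge_inf; [exists 0 => _ [? _ <-]; exact: nrm_ge0|exists j]. Qed.

Lemma dist_ge x r : (forall j, J j -> r <= nrm (x - j)) -> r <= dist x.
Proof.
move=> H; apply: lb_le_inf; first by exists (nrm (x - 0)), 0.
by move=> _ [j Jj <-]; exact: H.
Qed.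

Lemma dist_near x e : 0 < e -> exists2 j, J j & nrm (x - j) < dist x + e.
Proof.
move=> e0; have hi : has_inf [set nrm (x - j) | j in J].
  split; first by exists (nrm (x - 0)), 0.
  by exists 0 => _ [? _ <-]; exact: nrm_ge0.
by have [_ [j Jj <-] H] := inf_adherent e0 hi; exists j.
Qed.

Lemma dist_ge0 x : 0 <= dist x.
Proof. by apply: dist_ge => j _; exact: nrm_ge0. Qed.

Lemma dist_mem x : J x -> dist x = 0.
Proof.
move=> Jx; apply/eqP; rewrite eq_le dist_ge0 andbT.
by rewrite (le_trans (dist_le x Jx)) // subrr nrm0.
Qed.

(** [x - G x] lies in [J], so [dist x <= nrm (G x)]; and [G] is a contraction nearly killing [j], so
    [nrm (G (x (star x)))] is at most [nrm (x (star x) - j) + e]. *)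
Lemma dist_sqr_le x : dist x ^+ 2 <= dist (x ** star x).
Proof.
apply: dist_ge => j Jj; apply/ler_addgt0Pr => e e0.
have [G [G1 GJ Gj GD Gsq]] := approximate_unit Jj e0.
have dG : dist x <= nrm (G x) by have := dist_le x (GJ x); rewrite subKr.
apply: (@le_trans _ _ (nrm (G x) ^+ 2)).
  by rewrite lerXn2r // nnegrE ?dist_ge0 ?nrm_ge0.
rewrite (le_trans (Gsq x)) // -{1}(subrK j (x ** star x)) GD.
by rewrite (le_trans (nrmD _ _)) // lerD.
Qed.

Lemma dist_cstar_seminorm : cstar_seminorm dist.
Proof.
have dD x y : dist (x + y) <= dist x + dist y.
  apply/ler_addgt0Pr => e e0; have e20 : 0 < e / 2 by lra.
  have [j Jj Hj] := dist_near x e20; have [k Jk Hk] := dist_near y e20.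
  have := dist_le (x + y) (subgroupD JG Jj Jk); rewrite opprD addrACA.
  by have := nrmD (x - j) (y - k); lra.
have leZ (c : R[i]) x : normc c * dist x <= dist (c *: x).
  apply: dist_ge => j Jj; have [->|c0] := eqVneq c 0.
    by rewrite normc0 mul0r nrm_ge0.
  have -> : c *: x - j = c *: (x - c^-1 *: j).
    by rewrite scalerBr scalerA mulfV // scale1r.
  by rewrite nrmZ ler_wpM2l ?normc_ge0 // dist_le //; exact: JZ.
have dM x y : dist (x ** y) <= dist x * dist y.
  apply: le_mul_inf.
  - by exists (nrm (x - 0)), 0.
  - by exists (nrm (y - 0)), 0.
  - by move=> _ [j _ <-]; exact: nrm_ge0.
  - by move=> _ [j _ <-]; exact: nrm_ge0.
  move=> _ _ [j Jj <-] [k Jk <-]; apply: le_trans (nrmM _ _).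
  have -> : (x - j) ** (y - k) = x ** y - (x ** k + j ** (y - k)).
    by rewrite csmulBl csmulBr opprD addrA.
  apply: dist_le; apply: (subgroupD JG); first exact: (iJ.2 _ _ Jk).1.
  exact: (iJ.2 _ _ Jj).2.
(* [J] is not assumed closed under [star]; the inequality follows from [dist_sqr_le] and
   submultiplicativity. *)
have dstar x : dist x <= dist (star x).
  have [->|x0] := eqVneq (dist x) 0; first exact: dist_ge0.
  have xpos : 0 < dist x by rewrite lt0r x0 dist_ge0.
  by rewrite -(ler_pM2l xpos) -expr2 (le_trans (dist_sqr_le x)).
split=> //.
- move=> c x; apply/eqP; rewrite eq_le leZ andbT.
  have [->|c0] := eqVneq c 0; first by rewrite scale0r normc0 mul0r dist_mem.
  have n0 : normc c != 0 by apply: contra c0 => /eqP/eq0_normc ->.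
  have npos : 0 < normc c by rewrite lt0r n0 normc_ge0.
  by rewrite -ler_pdivrMl // -normcV (le_trans (leZ _ _)) // scalerA mulVf // scale1r.
- move=> x; apply/eqP; rewrite eq_le dist_sqr_le andbT (le_trans (dM _ _)) //.
  rewrite expr2 ler_wpM2l ?dist_ge0 //.
  by have := dstar (star x); rewrite csstarK.
Qed.

Lemma closure_dist x : dist x = 0 -> closure J x.
Proof.
move=> x0 B /nbhs_ballP[e /= e0 eB].
have [r r0 eE] : exists2 r : R, 0 < r & e = r%:C%C.
  case: e e0 {eB} => a b; rewrite ltcE /= => /andP[/eqP -> a0]; by exists a.
have [j Jj] := dist_near x r0; rewrite x0 add0r => Hj.
exists j; split=> //; apply: eB; rewrite -ball_normE /= eE nrmE ltcR; exact: Hj.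
Qed.

End Distance.

(** * The implications between the conditions *)

Section Main.
Variables (R : realType) (A : cstar_algebra R).

Local Notation "x ** y" := (@cs_mul R A x y) (at level 40, left associativity).
Local Notation star := (@cs_star R A).
Local Notation AA := (setT : set A).
Local Notation L := (@setcomm R A AA AA).

Let J := setmul (setmul AA L) AA.
Let iJ : ideal J := ideal_setmul2 L.

Lemma commutator_ideal_scale (c : R[i]) x : J x -> J (c *: x).
Proof.
move: x; apply: setmul2_min.
  apply: (@subgroup_preim _ _ (fun x => c *: x)) => //; last exact: iJ.1.
    exact: scaler0.
  by move=> x y; rewrite scalerBr.
by move=> a u b Lu; rewrite /= -!csmulZl; exact: setmul2_mem.
Qed.

Lemma no_character_commutator_ideal_dense : ~ has_character A -> closure J = AA.
Proof.
move=> nochar; apply/seteqP; split=> // k _; apply: contrapT => kJ.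
have cJ : cstar_seminorm (dist J) := dist_cstar_seminorm iJ commutator_ideal_scale.
have k0 : 0 < dist J k.
  rewrite lt0r (dist_ge0 iJ) andbT; apply/eqP => d0.
  by apply: kJ; exact: (closure_dist iJ).
have dcomm x y : dist J (x ** y - y ** x) = 0.
  set u := _ - _.
  (* The commutator [u] need not be in [J], but [u (star u) u (star u)] is, and its distance is the
     fourth power of that of [u]. *)
  have Ju : J ((u ** star u) ** star (u ** star u)).
    by rewrite csstarM csstarK csmulA; apply: setmul2_mem; exact: comm_setcomm.
  have := dist_mem iJ Ju; rewrite !(cqS cJ) => /eqP.
  by rewrite !expf_eq0 /= => /eqP.
have csn : @cseminorm R A (@cs_mul R A) (dist J).
  split; [exact: cqD cJ|exact: cqZ cJ|exact: cqM cJ| |exact: dcomm].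
  by move=> x; apply: cq_normal_sqr.
have [phi [phiD phiZ phiM _ phik]] := exists_character (@csmulA R A) (@csmulDl R A)
  (@csmulDr R A) (@csmulZl R A) (@csmulZr R A) csn k0.
apply: nochar; exists phi; split=> //; exists k.
by apply/eqP => pk0; move: k0; rewrite -phik pk0 normc0 ltxx.
Qed.

(** An element [y] of [I] within [1/2] of the unit [e] is right invertible: the limit [z] of the
    Neumann series in [w = e - y] satisfies [z = e + w z], so [y z = e]. *)
Lemma dense_ideal_full (I : set A) : cs_unital A -> ideal I -> closure I = AA -> I = AA.
Proof.
move=> [e eE] [IG IM] cI.
have [y [Iy ey]] : exists y, I y /\ nrm (e - y) <= 2^-1.
  have : closure I e by rewrite cI.
  have r0 : 0 < (2^-1 : R)%:C%C :> R[i] by rewrite ltcR invr_gt0.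
  move=> /(_ _ (nbhsx_ballx e _ r0))[y [Iy]].
  by rewrite -ball_normE /= nrmE ltcR => /ltW; exists y.
set w := e - y in ey.
pose u n := iter n (fun x => e + w ** x) 0.
have wn x : nrm (w ** x) <= 2^-1 * nrm x.
  by rewrite (le_trans (nrmM _ _)) // ler_wpM2r ?nrm_ge0.
have un n : nrm (u n) <= 2 * nrm e.
  elim: n => [|n IH]; first by rewrite nrm0 mulr_ge0 ?nrm_ge0.
  by rewrite /u /= (le_trans (nrmD _ _)) //; have := wn (u n); rewrite /u in IH *; lra.
have uB n k : nrm (u (n + k)%N - u n) <= 2^-1 ^+ n * (2 * nrm e).
  elim: n => [|n IH]; first by rewrite subr0 mul1r.
  rewrite addSn /u /= opprD addrACA subrr add0r -csmulBr (le_trans (wn _)) //.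
  by rewrite exprS -mulrA ler_wpM2l.
have [|z Hz] := @nrm_complete R A u.
  move=> d d0; have E0 : 0 < 2 * nrm e + 1 by have := nrm_ge0 e; lra.
  have [N HN] := @exp_lt_eps R 2^-1 (d / (2 * nrm e + 1)) ltac:(lra) ltac:(lra) (divr_gt0 d0 E0).
  exists N => n Nn; rewrite -(subnKC Nn) (le_trans (uB _ _)) //.
  have := HN N (leqnn N); rewrite ltr_pdivlMr // => /ltW; apply: le_trans.
  by rewrite ler_wpM2l ?lerDl // exprn_ge0.
have zE : z = e + w ** z.
  apply/eqP; rewrite -subr_eq0; apply/eqP/nrm_eq0/eqP.
  rewrite eq_le nrm_ge0 andbT; apply/ler_addgt0Pr => d d0; rewrite add0r.
  have d20 : 0 < d / 2 by lra.
  have [N HN] := Hz _ d20.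
  have -> : z - (e + w ** z) = (z - u N.+1) + w ** (u N - z).
    by rewrite /u /= csmulBr !opprD !addrA subrK.
  rewrite (le_trans (nrmD _ _)) // -nrmN opprB.
  by have := HN N.+1 (leqnSn N); have := HN N (leqnn N); have := wn (u N - z);
    have := nrm_ge0 (u N - z); lra.
have yz : y ** z = e.
  have -> : y = e - w by rewrite /w subKr.
  by rewrite csmulBl (eE z).1 {1}zE addrK.
apply/seteqP; split=> // x _; rewrite -(eE x).1 -yz.
by apply: (IM _ _ _).2; apply: (IM _ _ _).2.
Qed.

(** Multiplying by [a] and [b] from outside turns the unitization factors into elements of [A];
    [subgroup_triple_full] then removes [a] and [b]. *)
Lemma unitz_commutator_ideal_full : unitz_setmulr (unitz_setmull L) = AA -> J = AA.
Proof.
move=> C1; apply: subgroup_triple_full; first exact: iJ.1.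
have JG := subgroup_mullr iJ.1.
have HL : unitz_setmull L `<=` [set y | forall a b, J (a ** y ** b)].
  apply: addgen_min => // _ [v [x [Lx ->]]] a b.
  have -> : a ** unitz_mull v x = (a ** v.1 + v.2 *: a) ** x.
    by rewrite /unitz_mull !(csmulDr, csmulDl, csmulZr, csmulZl, csmulA).
  exact: setmul2_mem.
have HLr : unitz_setmulr (unitz_setmull L) `<=` [set y | forall a b, J (a ** y ** b)].
  apply: addgen_min => // _ [x [v [/HL Hx ->]]] a b.
  have -> : a ** unitz_mulr x v ** b = a ** x ** (v.1 ** b + v.2 *: b).
    by rewrite /unitz_mulr !(csmulDr, csmulDl, csmulZr, csmulZl, csmulA).
  exact: Hx.
by move=> a y b; apply: HLr; rewrite C1.
Qed.

(** The target is closed under right multiplication by [A], hence a subring, and contains the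
    commutators through the unit [(0, 1)]. *)
Lemma ringgen_unitz_commutator_ideal :
  ringgen [set z : A | exists x y, z = commutator x y] `<=`
  unitz_setmulr (unitz_setmull L).
Proof.
move=> x; apply.
- exact: addgen_subgroup.
- move=> y z + _; move: y; apply: addgen_min.
    exact: (subgroup_mulr z (addgen_subgroup _)).
  move=> _ [y [v [Hy ->]]]; apply: sub_addgen.
  exists y, (v.1 ** z + v.2 *: z, 0); split=> //.
  by rewrite /unitz_mulr /= scale0r addr0 !(csmulDr, csmulDl, csmulZr, csmulZl, csmulA).
- move=> _ [y [z ->]]; apply: sub_addgen; exists (commutator y z), (0, 1).
  rewrite /unitz_mulr /= csmul0r add0r scale1r; split=> //.
  apply: sub_addgen; exists (0, 1), (commutator y z).
  by rewrite /unitz_mull /= csmul0l add0r scale1r; split=> //; exact: comm_setcomm.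
Qed.

Lemma setmul_comm_ringgen : setmul L L = AA ->
  ringgen [set z : A | exists x y, z = commutator x y] = AA.
Proof.
move=> LL; apply/seteqP; split=> // x _ G GG GM GC.
have LG : L `<=` G by apply: setcomm_min => // y z _ _; apply: GC; exists y, z.
have : setmul L L x by rewrite LL.
by move: x; apply: setmul_min => // y z /LG Gy /LG Gz; exact: GM.
Qed.

Lemma commutator_ideal_no_character : J = AA -> ~ has_character A.
Proof.
move=> JA [phi [phiD phiZ phiM [x]]].
have phiN y : phi (- y) = - phi y by rewrite -scaleN1r phiZ mulN1r.
have kerG : is_addsubgroup [set y | phi y = 0].
  split=> [|y z /= y0 z0]; first by have := phiZ 0 0; rewrite scale0r mul0r.
  by rewrite phiD phiN y0 z0 subr0.
have kerL : L `<=` [set y | phi y = 0].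
  by apply: setcomm_min => // y z _ _; rewrite /= phiD phiN !phiM mulrC subrr.
have : J x by rewrite JA.
move=> Jx /eqP; apply; move: x Jx; apply: setmul2_min => // a u b /kerL u0.
by rewrite /= !phiM u0 mulr0 mul0r.
Qed.

End Main.

Theorem theorem4p1 (R : realType) (A : cstar_algebra R) :
  let AA : set A := setT in
  let C1 := unitz_setmulr (unitz_setmull (setcomm AA AA)) = AA in
  let C2 := setmul (setmul AA (setcomm AA AA)) AA = AA in
  let C3 := setmul (setmul AA (setcomm (setcomm AA AA) (setcomm AA AA))) AA = AA in
  let C4 := ringgen [set z | exists x y, z = commutator x y] = AA in
  let C5 := setmul (setcomm AA AA) (setcomm AA AA) = AA in
  let C6 := ~ has_character A in
  ((C1 <-> C2) /\ (C2 <-> C3) /\ (C3 <-> C4) /\ (C4 <-> C5)) /\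
  (C1 -> C6) /\
  (C6 -> closure (setmul (setmul AA (setcomm AA AA)) AA) = AA) /\
  (cs_unital A -> C6 -> C1).
Proof.
move=> AA C1 C2 C3 C4 C5 C6.
(* The equivalences close through the cycle (1), (2), (3), (5), (4), (1). *)
have C12 : C1 -> C2 := @unitz_commutator_ideal_full R A.
have C23 : C2 -> C3.
  move=> H2; apply: ideal_radical_full; first exact: ideal_setmul2.
  by move=> b; exact: power_in_double_commutator_ideal.
have C35 : C3 -> C5 := @setmul_comm_comm R A.
have C54 : C5 -> C4 := @setmul_comm_ringgen R A.
have C41 : C4 -> C1.
  move=> H4; apply/seteqP; split=> // x _; apply: ringgen_unitz_commutator_ideal.
  by rewrite [X in X x]H4.
have C26 : C2 -> C6 := @commutator_ideal_no_character R A.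
have C6d := @no_character_commutator_ideal_dense R A.
do ![split] => //; try by [tauto|move=> *; auto 10].
move=> uA H6; apply/C41/C54/C35/C23.
by apply: dense_ideal_full => //; [exact: ideal_setmul2|exact: C6d].
Qed.
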